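(* Let $V$ be a smooth real-valued function on $\mathbb R$ such that $V(x)=\sqrt{\ln|x|}$ for all sufficiently large $|x|$, and let $H^{\mathbb R}=-\partial_x^2+V(x)$. Let $S^1$ be the unit circle with Laplacian $\Delta^{S^1}$, and consider on $\mathbb R\times S^1$ the operator $$H^{\mathbb R\times S^1}=H^{\mathbb R}+\Delta^{S^1}.$$ Let $\mathcal N(\lambda,H^{\mathbb R\times S^1})$ be its eigenvalue counting function. Then $$\int_{S^1}\int_{\mathbb R}(\lambda-V(x))_+\,dx\,d\theta=o\big(\mathcal N(\lambda,H^{\mathbb R\times S^1})\big),\qquad\lambda\to\infty,$$ and consequently the classical Weyl law $\mathcal N(\lambda,H^{\mathbb R\times S^1})\sim(2\pi)^{-2}\omega_2\int_{S^1}\int_{\mathbb R}(\lambda-V(x))_+\,dx\,d\theta$ fails.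
   Context: $\Delta^{S^1}=-\partial_\theta^2$ is nonnegative, $s_+=\max\{s,0\}$, $\omega_2=\pi$ is the area of the unit disc. The operator $H^{\mathbb R\times S^1}$ is essentially self-adjoint with discrete spectrum, and its eigenvalue counting function counts eigenvalues less than $\lambda$ with multiplicity. $f\sim g$ means $f/g\to1$ as $\lambda\to\infty$. *)

(* Defs.v *)
From HB Require Import structures.
From mathcomp Require Import all_boot all_order all_algebra.
From mathcomp Require Import all_classical all_reals all_analysis.
From mathcomp Require Import complex.
Set Implicit Arguments.
Unset Strict Implicit.
Unset Printing Implicit Defensive.
Import Order.TTheory GRing.Theory Num.Theory.
Import numFieldNormedType.Exports.
Local Open Scope classical_set_scope.
Local Open Scope ring_scope.

(* Functions on R x S^1 are represented on R * R, the second coordinate being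
   the angle theta: smooth functions are 2 pi-periodic in theta, whereas an
   element of L^2(R x S^1) is a complex-valued function considered only on the
   fundamental domain [cylinder], up to Lebesgue-almost everywhere equality. *)

Section Smooth.
Context {R : realType}.
Implicit Types (u v : R -> R) (F : R * R -> R).

Definition smooth u : Prop :=
  forall (n : nat) (x : R), derivable (derive1n n u) x 1.

(* [false] is the variable x, [true] is the variable theta. *)
Definition slice (b : bool) F (p : R * R) : R -> R :=
  if b then fun t => F (p.1, t) else fun x => F (x, p.2).

Definition coord (b : bool) (p : R * R) : R := if b then p.2 else p.1.

Definition pderivable (b : bool) F : Prop :=
  forall p, derivable (slice b F p) (coord b p) 1.

Definition pderive (b : bool) F : R * R -> R :=
  fun p => derive1 (slice b F p) (coord b p).

(* C^infinity: the partial derivatives of all orders exist and are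
   continuous. *)
Definition smooth2 F : Prop :=
  forall s : seq bool, let G := foldr pderive F s in
    continuous G /\ forall b, pderivable b G.

End Smooth.

Section Operators.
Context {R : realType}.

Definition HR (V : R -> R) (u : R -> R) : R -> R :=
  fun x => - derive1n 2 u x + V x * u x.

Definition LapS1 (v : R -> R) : R -> R := fun t => - derive1n 2 v t.

Definition HRS1 (V : R -> R) (F : R * R -> R) : R * R -> R :=
  fun p => HR V (slice false F p) p.1 + LapS1 (slice true F p) p.2.

(* Extension to complex-valued functions: the derivatives of the real and of
   the imaginary part are taken separately, and V is real. *)
Definition HRS1C (V : R -> R) (F : R * R -> R[i]) : R * R -> R[i] :=
  fun p => Complex (HRS1 V (fun q => complex.Re (F q)) p)
                   (HRS1 V (fun q => complex.Im (F q)) p).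

(* C_c^infinity(R x S^1) *)
Definition test_function (F : R * R -> R[i]) : Prop :=
  [/\ smooth2 (fun p => complex.Re (F p)),
      smooth2 (fun p => complex.Im (F p)),
      forall x t, F (x, t + 2 * pi) = F (x, t) &
      exists M : R, forall x t, M < `|x| -> F (x, t) = 0].

End Operators.

Section HilbertSpace.
Context {R : realType}.
Implicit Types f g : R * R -> R[i].

Definition cylinder : set (R * R) := setT `*` `[0, 2 * pi[%classic.

Local Notation dxdtheta := (@lebesgue_measure R \x @lebesgue_measure R)%E.

Definition sqnorm f : \bar R :=
  (\int[dxdtheta]_(p in cylinder)
     (complex.Re (f p) ^+ 2 + complex.Im (f p) ^+ 2)%:E)%E.

Definition inL2 f : Prop :=
  [/\ measurable_fun cylinder (fun p => complex.Re (f p)),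
      measurable_fun cylinder (fun p => complex.Im (f p)) &
      (sqnorm f < +oo)%E].

Definition eq_ae f g : Prop :=
  {ae dxdtheta, forall p, cylinder p -> f p = g p}.

(* Linear independence over the complex numbers in L^2(R x S^1). *)
Definition lin_indep (n : nat) (f : 'I_n -> R * R -> R[i]) : Prop :=
  forall c : 'I_n -> R[i],
    eq_ae (fun p => \sum_(i < n) c i * f i p) (fun=> 0) -> forall i, c i = 0.

End HilbertSpace.

Section Spectrum.
Context {R : realType}.
Variable V : R -> R.

(* The graph of the self-adjoint operator H^{R x S^1}, that is, the closure in
   L^2 x L^2 of the graph of H^{R x S^1} on C_c^infinity(R x S^1). *)
Definition Hgraph (f g : R * R -> R[i]) : Prop :=
  [/\ inL2 f, inL2 g &
      exists phi : nat -> R * R -> R[i],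
      [/\ forall n, test_function (phi n),
          sqnorm (fun p => phi n p - f p) @[n --> \oo] --> 0%E &
          sqnorm (fun p => HRS1C V (phi n) p - g p) @[n --> \oo] --> 0%E]].

Definition H_eigenspace (mu : R) : set (R * R -> R[i]) :=
  [set f | Hgraph f (fun p => mu%:C%C * f p)].

Definition H_eigenvalue (mu : R) : Prop :=
  exists2 f, H_eigenspace mu f & ~ eq_ae f (fun=> 0).

(* The complex dimension of the eigenspace, as an element of [0, +oo]. *)
Definition H_multiplicity (mu : R) : \bar R :=
  ereal_sup [set n%:R%:E | n in [set n : nat |
    exists f : 'I_n -> R * R -> R[i],
      (forall i, H_eigenspace mu (f i)) /\ lin_indep f]].

(* With values in [0, +oo], so that no finiteness is built into the
   definition. *)
Definition H_counting (lam : R) : \bar R :=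
  \esum_(mu in [set mu | H_eigenvalue mu /\ mu < lam]) H_multiplicity mu.

Definition phase_integral (lam : R) : \bar R :=
  (\int[lebesgue_measure]_(t in `[0%R, (2 * pi)%R[)
     \int[lebesgue_measure]_x (Num.max (lam - V x)%R 0%R)%:E)%E.

End Spectrum.

Section Asymptotics.
Context {R : realType}.
Implicit Types f g : R -> \bar R.

Definition little_o f g : Prop :=
  forall eps : R, 0 < eps ->
    \forall lam \near +oo%R, (`|f lam| <= eps%:E * `|g lam|)%E.

Definition asymp_equiv f g : Prop :=
  (f lam / g lam)%E @[lam --> +oo%R] --> 1%E.

End Asymptotics.

(* The area of the unit disc. *)
Definition omega2 {R : realType} : R := pi.

(* Main.v *)
Require Import Defs.
From HB Require Import structures.
From mathcomp Require Import all_boot all_order all_algebra.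
From mathcomp Require Import all_classical all_reals all_analysis.
From mathcomp Require Import measurable_realfun complex ring lra.
Set Implicit Arguments.
Unset Strict Implicit.
Unset Printing Implicit Defensive.
Import Order.TTheory GRing.Theory Num.Theory.
Import numFieldNormedType.Exports.
Local Open Scope classical_set_scope.
Local Open Scope ring_scope.

(** The eigenfunctions that do not depend on the angle are already numerous
enough to beat the phase integral: they are the bound states of H^R, and there
are at least about e^(lam^2) / sqrt lam of them below lam, whereas the phase
integral is at most of order e^(lam^2) / lam.  The reason is that the region
where V is close to lam is exponentially larger than the rest: on
|x| <= L = e^(lam^2 - 2) the potential is at most lam - 1 / lam, so a solution
of - u'' + V u = E u with E near lam still oscillates there with frequency
of order lam^(-1/2) and has about L / sqrt lam zeros, while lam - V, which is
what the phase integral sees, is only of order 1 / lam on most of that region.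

The oscillation count is made with a scaled Pruefer angle: u = r sin psi and
u' = k r cos psi turn the eigenvalue equation into
psi' = k - Q sin^2 psi with Q = (k^2 + V - E) / k.  Where E - V >= k^2 the angle
grows at least at speed k ([pruefer_growth]), it never crosses a multiple of pi
downwards ([pruefer_ge]), and it is trapped in a quarter turn in the region
V > E.  The intermediate value theorem in E then provides, for each j with
j pi <= 2 k L, a Dirichlet eigenvalue on [- T, T] whose angle turns by exactly
j pi ([shooting]).  Letting T tend to infinity along a cluster point of the
energies and of the initial angles gives a solution on the line whose angle
lies in [0, pi / 2] far to the left and in [j pi - pi / 2, j pi] far to the
right ([bound_state_angle]).  The limits for distinct j have distinct energies,
because the left condition determines the angle ([left_angle_unique]) and the
right condition determines j.

The two angle conditions say that u u' is nonnegative far to the left and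
nonpositive far to the right.  Since (u u')' = u'^2 + (V - E) u^2 dominates
u^2 + u'^2 there, both u and u' are square integrable
([bound_state_integrable]), and cutting u off smoothly at distance n puts it
in the domain of the closure of H ([eigenfunction_Hgraph]).

The upper bound on the phase integral follows from
lam - sqrt y <= (lam^2 - y) / lam for y = ln |x|, and from the integrability of
the logarithm ([phase_integral_upper]). *)

(** * Differential inequalities and primitives *)

Section Calculus.
Context {R : realType}.
Implicit Types (f g F G p y : R -> R) (a b x t : R).

Lemma deriv_continuous f g x : is_derive x 1 f (g x) -> {for x, continuous f}.
Proof. by move=> [df _]; exact/differentiable_continuous/derivable1_diffP. Qed.

Lemma continuous_sqr f : continuous f -> continuous (fun x => f x ^+ 2).
Proof.
move=> cf x.
apply: (@cvg_comp _ _ _ f (fun y : R => y ^+ 2) _ _ _ (cf x)); exact: exprn_continuous.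
Qed.

Lemma deriv_ge0_le f g a b : a <= b ->
  (forall x, a <= x <= b -> is_derive x 1 f (g x)) ->
  (forall x, a <= x <= b -> 0 <= g x) -> f a <= f b.
Proof.
move=> ab df g0.
have cf : {within `[a, b], continuous f}.
  apply: derivable_within_continuous => x; rewrite in_itv /= => xab.
  by have [] := df x xab.
have [|c] := @MVT_segment R f g a b ab _ cf.
  by move=> x; rewrite in_itv /= => /andP[ax xb]; apply: df; rewrite !ltW.
rewrite in_itv /= => cab e.
by rewrite -subr_ge0 e mulr_ge0 ?subr_ge0 ?g0.
Qed.

Lemma deriv_le0_ge f g a b : a <= b ->
  (forall x, a <= x <= b -> is_derive x 1 f (g x)) ->
  (forall x, a <= x <= b -> g x <= 0) -> f b <= f a.
Proof.
move=> ab df g0; rewrite -lerN2.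
apply: (@deriv_ge0_le (- f) (fun x => - g x) a b ab) => x /[dup] xab /df dfx.
  exact: is_deriveN.
by rewrite oppr_ge0 g0.
Qed.

Lemma deriv_le_le F G f g a b : a <= b ->
  (forall x, a <= x <= b -> is_derive x 1 F (f x)) ->
  (forall x, a <= x <= b -> is_derive x 1 G (g x)) ->
  (forall x, a <= x <= b -> f x <= g x) -> F b - F a <= G b - G a.
Proof.
move=> ab dF dG fg.
have : (G - F) a <= (G - F) b.
  apply: (@deriv_ge0_le _ (fun x => g x - f x) a b ab) => x /[dup] xab.
    by move=> /[dup] /dF ? /dG ?; exact: is_deriveB.
  by move=> /fg; rewrite subr_ge0.
by rewrite /= !fctE; lra.
Qed.

(** With absolute values on both sides, one inequality covers the points on
either side of the base point of a primitive. *)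
Lemma deriv_dist_le F G f g a b :
  (forall x, is_derive x 1 F (f x)) -> (forall x, is_derive x 1 G (g x)) ->
  (forall x, `|f x| <= g x) -> `|F b - F a| <= `|G b - G a|.
Proof.
move=> dF dG fg.
wlog ab : a b / a <= b.
  move=> H; case: (leP a b) => [|/ltW] ab; first exact: H.
  by rewrite distrC [leRHS]distrC; exact: H.
have h1 : F b - F a <= G b - G a.
  apply: (@deriv_le_le _ _ f g) => // x _.
  by rewrite (le_trans _ (fg x)) // ler_norm.
have h2 : (- F) b - (- F) a <= G b - G a.
  apply: (@deriv_le_le _ _ (fun x => - f x) g) => // x _.
  by rewrite (le_trans _ (fg x)) // -normrN ler_norm.
apply: le_trans (ler_norm _).
by rewrite ler_norml; move: h2; rewrite !fctE; lra.
Qed.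

(** The integral from - N to x is a primitive on ] - N, +oo [ only;
subtracting its value at 0 removes the dependence on N, so that the base point
can move with x. *)
Lemma antiderivative f a : continuous f ->
  exists2 F : R -> R, F a = 0 & forall x, is_derive x 1 F (f x).
Proof.
move=> cf.
pose I N x : R := (\int[lebesgue_measure]_(t in `[- N, x]) f t)%R.
have dI N x : - N < x -> is_derive x 1 (I N) (f x).
  move=> Nx.
  have xu : x < x + 1 by rewrite ltrDl.
  have fi : lebesgue_measure.-integrable `[- N, x + 1] (EFin \o f).
    apply: continuous_compact_integrable; first exact: segment_compact.
    exact: continuous_subspaceT.
  have [d1 d2] := continuous_FTC1_closed xu fi Nx (cf x).
  by apply: DeriveDef; [exact: d1 | rewrite -derive1E; exact: d2].
have I_indep N M x : `|x| < N -> `|x| < M -> I N x - I N 0 = I M x - I M 0.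
  move=> xN xM.
  have key u v : u <= v -> - N < u -> - M < u -> I N v - I N u = I M v - I M u.
    move=> uv Nu Mu; apply/eqP; rewrite eq_le.
    apply/andP; split; apply: (@deriv_le_le _ _ f f) => // t /andP[ut tv];
      apply: dI; exact: lt_le_trans ut.
  move: xN xM; rewrite !ltr_norml => /andP[xN Nx] /andP[xM Mx].
  case: (leP 0 x) => x0.
    by apply: key => //; lra.
  by rewrite -[LHS]opprB -[RHS]opprB (key x 0 (ltW x0) xN xM).
pose F0 x := I (`|x| + 1) x - I (`|x| + 1) 0.
have dF0 x : is_derive x 1 F0 (f x).
  pose N := `|x| + 2.
  have Nx : - N < x by rewrite /N; have := ler_norm (- x); rewrite normrN; lra.
  apply: (@near_eq_is_derive _ _ _ (fun t => I N t - I N 0)).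
  - near=> t; rewrite /F0.
    have tx : `|t - x| < 1 by near: t; exact: (@cvgr_distC_lt _ _ _ _ _ idfun).
    have tN : `|t| < N by rewrite /N; have := ler_normD (t - x) x; rewrite subrK; lra.
    by apply: I_indep => //; rewrite ltrDl.
  - have := dI _ _ Nx => d.
    by apply: is_derive_eq; rewrite subr0.
exists (fun x => F0 x - F0 a); first by rewrite subrr.
by move=> x; have := dF0 x => d; apply: is_derive_eq; rewrite subr0.
Unshelve. all: by end_near. Qed.

(** If f b < 0, then at the last point of [a, b] where f >= 0 continuity gives
f = 0, and a positive derivative there would make f positive just after it. *)
Lemma barrier f g a b : a <= b -> (forall x, is_derive x 1 f (g x)) ->
  0 <= f a -> (forall x, a <= x <= b -> f x = 0 -> 0 < g x) -> 0 <= f b.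
Proof.
move=> ab df fa0 g0; rewrite leNgt; apply/negP => fb0.
have cf : continuous f by move=> x; exact: deriv_continuous.
pose S := [set x | a <= x <= b /\ 0 <= f x].
have supS : has_sup S.
  split; first by exists a; rewrite /S /= lexx ab.
  by exists b => x [] /andP[].
have aS : a <= sup S by apply: ub_le_sup; [case: supS | rewrite /S /= lexx ab].
have Sb : sup S <= b by apply: ge_sup; [case: supS | move=> x [] /andP[]].
set s := sup S in aS Sb *.
have above t : s < t -> t <= b -> f t < 0.
  move=> st tb; rewrite ltNge; apply/negP => ft.
  suff : t <= s by rewrite leNgt st.
  apply: ub_le_sup; first by case: supS.
  by split=> //; rewrite tb andbT (le_trans aS) // ltW.
have fs0 : 0 <= f s.
  rewrite leNgt; apply/negP => fs.
  have : \forall t \near s, f t < 0 by apply: (cvgr_lt _ (cf s)).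
  move=> /nbhs_ballP[e /= e0 eP].
  have [t St st] := sup_adherent e0 supS.
  have ts : t <= s by apply: ub_le_sup => //; case: supS.
  have := eP t; rewrite /ball /= ger0_norm ?subr_ge0 // => /(_ _).
  by move: St => [_]; rewrite leNgt => /negP h /(_ _)/h; apply; rewrite -/s in st; lra.
have sb : s < b.
  by rewrite lt_neqAle Sb andbT; apply/eqP => sb; move: fs0; rewrite sb leNgt fb0.
have fs : f s = 0.
  apply/eqP; rewrite eq_le fs0 andbT leNgt; apply/negP => fs.
  have : \forall t \near s, 0 < f t by apply: (cvgr_gt _ (cf s)).
  move=> /nbhs_ballP[e /= e0 eP].
  pose t := Num.min b (s + e / 2).
  have st : s < t by rewrite /t lt_min sb; lra.
  have tb : t <= b by rewrite /t ge_min lexx.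
  have te : t <= s + e / 2 by rewrite /t ge_min lexx orbT.
  have := above t st tb; rewrite ltNge => /negP; apply; apply: ltW.
  by apply: eP; rewrite /ball /= distrC ger0_norm ?subr_ge0 ?ltW //; lra.
have gs : 0 < g s by apply: g0 => //; rewrite aS Sb.
have [/derivableP d e] := df s.
have : h^-1 * (f (h + s) - f s) @[h --> 0^'] --> g s.
  by move: d => [d _]; move: d => /cvg_ex[l dl];
  move: (dl) => /cvg_lim; rewrite -e /derive => -> //; move: dl;
  under eq_fun do rewrite /= [_%:A]mulr1.
move=> /(cvgr_gt _)/(_ _ gs); rewrite /dnbhs /within /= => /nbhs_ballP[r /= r0 rP].
pose t := Num.min b (s + r / 2).
have st : s < t by rewrite /t lt_min sb; lra.
have tb : t <= b by rewrite /t ge_min lexx.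
have te : t <= s + r / 2 by rewrite /t ge_min lexx orbT.
have h0 : 0 < t - s by rewrite subr_gt0.
have := rP (t - s); rewrite /ball /= sub0r normrN gtr0_norm //.
rewrite subrK fs subr0 => /(_ _ _).
have ft := above t st tb.
move=> H; have : 0 < (t - s)^-1 * f t by apply: H; [lra | rewrite gt_eqF].
by rewrite pmulr_rgt0 ?invr_gt0 // ltNge (ltW ft).
Qed.

End Calculus.

(** * Scalar ordinary differential equations *)

Section ODE.
Context {R : realType}.
Implicit Types (p y P : R -> R) (a b x t : R).

Lemma le_of_le_geometric (x y C : R) :
  (forall n, x <= y + C / 2 ^+ n) -> x <= y.
Proof.
move=> H; apply/ler_addgt0Pr => e e0.
have /cvgrPdist_lt/(_ e e0) : C / 2 ^+ n @[n --> \oo] --> (0 : R).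
  have := @cvg_geometric R C (2^-1); rewrite ger0_norm ?invr_ge0 //.
  rewrite invf_lt1 ?ltr1n // => /(_ isT); rewrite /geometric /=.
  by under eq_fun do rewrite exprVn.
move=> [N _ /(_ N (leqnn N))] /=; rewrite sub0r normrN => h.
by rewrite (le_trans (H N)) // lerD2l (le_trans (ler_norm _)) // ltW.
Qed.

(** The sequences u n - 2 C / 2^n and u n + 2 C / 2^n are monotone and squeeze
the limit, which is the supremum of the former. *)
Lemma geometric_limit (u : nat -> R) C :
  (forall n, `|u n.+1 - u n| <= C / 2 ^+ n) ->
  exists l, forall n, `|l - u n| <= 2 * C / 2 ^+ n.
Proof.
move=> H.
pose lo n := u n - 2 * C / 2 ^+ n; pose up n := u n + 2 * C / 2 ^+ n.
have C0 : 0 <= C.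
  by have := H 0%N; rewrite expr0 divr1; exact: le_trans.
have e0 n : 0 <= 2 * C / 2 ^+ n by rewrite divr_ge0 ?exprn_ge0 ?mulr_ge0.
have eS n : 2 * C / 2 ^+ n = C / 2 ^+ n + 2 * C / 2 ^+ n.+1.
  rewrite exprS; field; by rewrite expf_neq0.
have loS n : lo n <= lo n.+1.
  by have := eS n; have := H n; rewrite ler_norml /lo; lra.
have upS n : up n.+1 <= up n.
  by have := eS n; have := H n; rewrite ler_norml /up; lra.
have lomono n m : (n <= m)%N -> lo n <= lo m.
  by apply: (homo_leq (@lexx _ R) (@le_trans _ R)).
have upmono n m : (n <= m)%N -> up m <= up n.
  apply: (@homo_leq _ up (fun a b => b <= a)) => //.
  by move=> ? ? ? h1 h2; exact: le_trans h2 h1.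
have loup n m : lo n <= up m.
  apply: (@le_trans _ _ (lo (maxn n m))); first by rewrite lomono ?leq_maxl.
  apply: (@le_trans _ _ (up (maxn n m))); last by rewrite upmono ?leq_maxr.
  by rewrite /lo /up; have := e0 (maxn n m); lra.
have hs : has_sup (range lo).
  by split; [exists (lo 0%N), 0%N | exists (up 0%N) => _ [n _ <-]].
exists (sup (range lo)) => n.
have h1 : lo n <= sup (range lo) by apply: ub_le_sup; [case: hs | exists n].
have h2 : sup (range lo) <= up n.
  by apply: ge_sup; [case: hs | move=> _ [m _ <-]].
by rewrite ler_norml; move: h1 h2; rewrite /lo /up; lra.
Qed.

(** Picard iteration, convergent on the whole line at once: in the weight W =
e^(2 P) + e^(- 2 P), where P is a primitive of the Lipschitz bound p, the map
T is a contraction of ratio 1/2, because e^(2 P) - e^(- 2 P) is a primitive of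
2 p W and is bounded by W. *)
Lemma ode_exists (f : R -> R -> R) p (x0 y0 : R) : continuous p ->
  (forall x a, `|f x a| <= p x) ->
  (forall x a b, `|f x a - f x b| <= p x * `|a - b|) ->
  (forall y, continuous y -> continuous (fun x => f x (y x))) ->
  exists2 y : R -> R, y x0 = y0 & forall x, is_derive x 1 y (f x (y x)).
Proof.
move=> cp fp flip fc.
have [P P0 dP] := antiderivative x0 cp.
have [I IP] : exists I : (R -> R) -> R -> R, forall g, continuous g ->
    I g x0 = 0 /\ forall x, is_derive x 1 (I g) (g x).
  have /choice[I IP] : forall g : R -> R, exists F : R -> R, continuous g ->
      F x0 = 0 /\ forall x, is_derive x 1 F (g x).
    move=> g; have [cg|ncg] := pselect (continuous g); last by exists (cst 0).
    by have [F F0 dF] := antiderivative x0 cg; exists F.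
  by exists I.
have p0 x : 0 <= p x by apply: le_trans (fp x 0).
pose W x := expR (2 * P x) + expR (- (2 * P x)).
pose S x := expR (2 * P x) - expR (- (2 * P x)).
have W1 x : 1 <= W x.
  have e1 (z : R) : 0 <= z -> 1 <= expR z by have := expR_ge1Dx z; lra.
  rewrite /W; case: (leP 0 (P x)) => h.
    have : 1 <= expR (2 * P x) by apply: e1; lra.
    by have := expR_gt0 (- (2 * P x)); lra.
  have : 1 <= expR (- (2 * P x)) by apply: e1; lra.
  by have := expR_gt0 (2 * P x); lra.
have SW x : `|S x| <= W x.
  have := expR_gt0 (2 * P x); have := expR_gt0 (- (2 * P x)).
  by rewrite ler_norml /S /W; lra.
have Sx0 : S x0 = 0 by rewrite /S P0 mulr0 oppr0 subrr.
have dS x : is_derive x 1 S (2 * (p x * W x)).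
  have ? := dP x; rewrite /S.
  apply: is_derive_eq; rewrite /W /GRing.scale /=; ring.
have weight (F h : R -> R) C : 0 <= C -> F x0 = 0 ->
    (forall x, is_derive x 1 F (h x)) ->
    (forall x, `|h x| <= 2 * (C * (p x * W x))) -> forall x, `|F x| <= C * W x.
  move=> C0 F0 dF hb x.
  have dCS t : is_derive t 1 (fun x => C * S x) (2 * (C * (p t * W t))).
    by have ? := dS t; apply: is_derive_eq; rewrite /GRing.scale /=; ring.
  have := @deriv_dist_le R F _ h _ x0 x dF dCS hb.
  rewrite F0 Sx0 mulr0 !subr0 => /le_trans; apply.
  by rewrite normrM ger0_norm // ler_wpM2l.
pose T (y : R -> R) := fun x => y0 + I (fun t => f t (y t)) x.
have dT y : continuous y -> forall x, is_derive x 1 (T y) (f x (y x)).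
  move=> cy x; have [_ d] := IP _ (fc _ cy); have ? := d x.
  rewrite /T; apply: is_derive_eq.
  by rewrite add0r mul1r.
have Tx0 y : continuous y -> T y x0 = y0.
  by move=> cy; have [e _] := IP _ (fc _ cy); rewrite /T e addr0.
pose Y n := iter n T (cst y0).
have cY n : continuous (Y n).
  elim: n => [|n cYn] x; first exact: cst_continuous.
  by apply: (@deriv_continuous _ _ (fun x => f x (Y n x))); exact: dT.
have Tdist y z C : continuous y -> continuous z -> 0 <= C ->
    (forall x, `|y x - z x| <= 2 * C * W x) ->
    forall x, `|T y x - T z x| <= C * W x.
  move=> cy cz C0 yz.
  apply: (weight (T y - T z) (fun x => f x (y x) - f x (z x))) => //.
  - by rewrite !fctE !Tx0 // subrr.
  - by move=> x; have ? := dT y cy x; have ? := dT z cz x; exact: is_deriveB.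
  - move=> x; apply: (le_trans (flip _ _ _)).
    have -> : 2 * (C * (p x * W x)) = p x * (2 * C * W x) by ring.
    exact: ler_wpM2l.
have YS n x : `|Y n.+1 x - Y n x| <= W x / 2 ^+ n.
  elim: n x => [|n IH] x.
    rewrite expr0 divr1 -[leRHS]mul1r.
    apply: (weight (Y 1%N - Y 0%N) (fun x => f x y0)) => // {x}.
    - by rewrite -[LHS]/(T (cst y0) x0 - y0) (Tx0 _ (cY 0%N)) subrr.
    - move=> x; rewrite -[f x y0]subr0; apply: is_deriveB.
      exact: (dT _ (cY 0%N)).
    - move=> x; apply: (le_trans (fp _ _)).
      by rewrite mul1r; have := p0 x; have := W1 x; nra.
  have -> : W x / 2 ^+ n.+1 = (2 ^+ n.+1)^-1 * W x by rewrite mulrC.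
  apply: (Tdist _ _ _ (cY n.+1) (cY n)) => [|t]; first by rewrite invr_ge0 exprn_ge0.
  apply: (le_trans (IH t)); rewrite exprS le_eqVlt; apply/orP; left; apply/eqP.
  by field; rewrite expf_neq0.
have /choice[y yP] : forall x, exists l, forall n, `|l - Y n x| <= 2 * W x / 2 ^+ n.
  by move=> x; exact: geometric_limit.
have Ylip n a b : `|Y n b - Y n a| <= `|P b - P a|.
  case: n => [|n]; first by rewrite subrr normr0.
  apply: (@deriv_dist_le R _ _ (fun x => f x (Y n x)) p) => // x.
  exact: (dT _ (cY n)).
have ylip a b : `|y b - y a| <= `|P b - P a|.
  apply: (@le_of_le_geometric _ _ (2 * W a + 2 * W b)) => n.
  have -> : y b - y a = (y b - Y n b) + (Y n b - Y n a) + (Y n a - y a) by ring.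
  apply: le_trans (ler_normD _ _) _.
  have := ler_normD (y b - Y n b) (Y n b - Y n a).
  have := Ylip n a b; have := yP a n; have := yP b n.
  rewrite distrC [`|Y n a - y a|]distrC mulrDl; lra.
have cy : continuous y.
  move=> x; apply/cvgrPdist_lt => e e0.
  have cPx : {for x, continuous P} by exact: deriv_continuous.
  have /cvgrPdist_lt/(_ e e0) := cPx.
  by apply: filterS => t; exact: le_lt_trans.
have Ty : T y = y.
  apply/funext => x; apply/eqP; rewrite -subr_eq0 -normr_le0.
  apply: (@le_of_le_geometric _ _ (2 * W x)) => n; rewrite add0r.
  have -> : T y x - y x = (T y x - Y n.+1 x) + (Y n.+1 x - y x) by ring.
  apply: (le_trans (ler_normD _ _)).
  have h1 : `|T y x - Y n.+1 x| <= (2 ^+ n)^-1 * W x.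
    apply: (Tdist _ _ _ cy (cY n)) => [|t]; first by rewrite invr_ge0 exprn_ge0.
    by apply: (le_trans (yP t n)); rewrite mulrAC.
  have h2 := yP x n.+1; rewrite distrC in h2.
  have e : 2 * W x / 2 ^+ n = (2 ^+ n)^-1 * W x + 2 * W x / 2 ^+ n.+1.
    by rewrite exprS; field; rewrite expf_neq0.
  by rewrite e; exact: lerD.
exists y; first by rewrite -Ty Tx0.
by move=> x; rewrite -{1}Ty; exact: dT.
Qed.

(** Working with w^2 + eta^2 instead of |w| + |eta| keeps everything
differentiable: 2 w w' <= 3 p (w^2 + eta^2), so that (w^2 + eta^2) e^(- 3 P)
is nonincreasing, and (w^2 + eta^2) e^(3 P) nondecreasing. *)
Lemma gronwall (w w' p P : R -> R) (eta a b : R) :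
  (forall x, 0 <= p x) ->
  (forall x, is_derive x 1 w (w' x)) -> (forall x, is_derive x 1 P (p x)) ->
  (forall x, `|w' x| <= p x * (`|w x| + `|eta|)) ->
  w b ^+ 2 + eta ^+ 2 <= (w a ^+ 2 + eta ^+ 2) * expR (3 * `|P b - P a|).
Proof.
move=> p0 dw dP ww.
have key x : `|2 * (w x * w' x)| <= 3 * p x * (w x ^+ 2 + eta ^+ 2).
  rewrite normrM normrM (ger0_norm (ler0n _ 2)) -(real_normK (num_real (w x))).
  rewrite -(real_normK (num_real eta)).
  have := ww x; have := p0 x; have := normr_ge0 (w x); have := normr_ge0 eta.
  move: `|w x| `|w' x| `|eta| => u v e e0 u0 q0 vq.
  have h1 : u * v <= u * (p x * (u + e)) by exact: ler_wpM2l.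
  have h2 : 0 <= p x * (u - e) ^+ 2 by rewrite mulr_ge0 ?sqr_ge0.
  have h3 : 0 <= p x * e ^+ 2 by rewrite mulr_ge0 ?sqr_ge0.
  have -> : 3 * p x * (u ^+ 2 + e ^+ 2) =
    2 * (u * (p x * (u + e))) + p x * (u - e) ^+ 2 + 2 * (p x * e ^+ 2) by ring.
  lra.
have dG (s x : R) : is_derive x 1 (fun x => (w x ^+ 2 + eta ^+ 2) * expR (s * P x))
   ((2 * (w x * w' x) + s * p x * (w x ^+ 2 + eta ^+ 2)) * expR (s * P x)).
  have ? := dw x; have ? := dP x.
  by apply: is_derive_eq; rewrite /GRing.scale /=; ring.
have S0 x : 0 <= w x ^+ 2 + eta ^+ 2 by rewrite addr_ge0 ?sqr_ge0.
have fin (s : R) : (w b ^+ 2 + eta ^+ 2) * expR (s * P b) <=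
    (w a ^+ 2 + eta ^+ 2) * expR (s * P a) -> s * (P a - P b) <= 3 * `|P b - P a| ->
  w b ^+ 2 + eta ^+ 2 <= (w a ^+ 2 + eta ^+ 2) * expR (3 * `|P b - P a|).
  move=> h1 h2; rewrite -(ler_pM2r (expR_gt0 (s * P b))) (le_trans h1) //.
  by rewrite -mulrA -expRD ler_wpM2l // ler_expR; lra.
have nrm := ler_norm (P b - P a); have nrm' := ler_norm (- (P b - P a)).
rewrite normrN in nrm'.
case: (leP a b) => ab.
  apply: (fin (- 3)); last by lra.
  apply: (@deriv_le0_ge R _ _ a b ab (fun x _ => dG (- 3) x)) => x _.
  rewrite mulr_le0_ge0 ?expR_ge0 //.
  by have := ler_norm (2 * (w x * w' x)); have := key x; lra.
apply: (fin 3); last by lra.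
apply: (@deriv_ge0_le R _ _ b a (ltW ab) (fun x _ => dG 3 x)) => x _.
rewrite mulr_ge0 ?expR_ge0 //.
by have := ler_norm (- (2 * (w x * w' x))); rewrite normrN; have := key x; lra.
Qed.

End ODE.

(** * Smooth functions of one variable and cutoffs *)

Section SmoothFunctions.
Context {R : realType}.
Implicit Types (x t : R) (u v : R -> R) (S B : set (R -> R)).

Lemma derive1nSr (n : nat) u : derive1n n.+1 u = derive1n n (derive1 u).
Proof. exact: iterSr. Qed.

Lemma is_derive_derive1 u v : (forall x : R, is_derive x 1 u (v x)) -> derive1 u = v.
Proof. by move=> du; apply/funext => x; have [_ <-] := du x; rewrite derive1E. Qed.

(** A class of functions stable under differentiation consists of smooth
functions; the smoothness results below only have to exhibit such a class. *)
Lemma smooth_coind S :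
  (forall v, S v -> exists2 v', S v' & forall x, is_derive x 1 v (v' x)) ->
  forall u, S u -> smooth u.
Proof.
move=> HS u Su n x.
have : S (derive1n n u).
  elim: n => [//|n /HS[v' Sv' dv']].
  by rewrite derive1nS (is_derive_derive1 dv').
by move=> /HS[v' _ /(_ x)[]].
Qed.

Lemma smooth_derive u : smooth u ->
  smooth (derive1 u) /\ forall x, is_derive x 1 u (derive1 u x).
Proof.
move=> su; split=> [n x|x]; first by rewrite -derive1nSr; exact: su.
by apply: DeriveDef; [exact: (su 0%N) | rewrite derive1E].
Qed.

Inductive function_algebra B : (R -> R) -> Prop :=
| alg_base u of B u : function_algebra B u
| alg_add u v of function_algebra B u & function_algebra B v : function_algebra B (fun x => u x + v x)
| alg_mul u v of function_algebra B u & function_algebra B v : function_algebra B (fun x => u x * v x).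

(** By the Leibniz rule it suffices to differentiate the generators inside the
algebra that they generate. *)
Lemma smooth_function_algebra B :
  (forall b, B b -> exists2 b', function_algebra B b' & forall x, is_derive x 1 b (b' x)) ->
  forall u, function_algebra B u -> smooth u.
Proof.
move=> HB; apply: smooth_coind => v; elim=> {v} [b /HB //|u v Au [u' Au' du] Av [v' Av' dv]
  |u v Au [u' Au' du] Av [v' Av' dv]].
- exists (fun x => u' x + v' x); first exact: alg_add.
  by move=> x; have ? := du x; have ? := dv x; exact: is_deriveD.
- exists (fun x => u x * v' x + v x * u' x).
    by apply: alg_add; exact: alg_mul.
  by move=> x; have ? := du x; have ? := dv x; exact: is_deriveM.
Qed.

Lemma smoothD u v : smooth u -> smooth v -> smooth (fun x => u x + v x).
Proof.
move=> su sv; apply: (@smooth_function_algebra smooth).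
  by move=> b /smooth_derive[sb' db]; exists (derive1 b) => //; exact: alg_base.
by apply: alg_add; exact: alg_base.
Qed.

Lemma smoothM u v : smooth u -> smooth v -> smooth (fun x => u x * v x).
Proof.
move=> su sv; apply: (@smooth_function_algebra smooth).
  by move=> b /smooth_derive[sb' db]; exists (derive1 b) => //; exact: alg_base.
by apply: alg_mul; exact: alg_base.
Qed.

Lemma smooth_cst (c : R) : smooth (fun=> c).
Proof.
apply: (@smooth_coind [set u | exists c, u = fun=> c]); last by exists c.
by move=> _ [d ->]; exists (fun=> 0); [exists 0 | move=> x; exact: is_derive_cst].
Qed.

Lemma smooth_primitive u v : smooth v -> (forall x, is_derive x 1 u (v x)) -> smooth u.
Proof.
move=> sv du; apply: (@smooth_coind [set w | w = u \/ smooth w]); last by left.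
move=> w [->|/smooth_derive[sw dw]]; first by exists v => //; right.
by exists (derive1 w) => //; right.
Qed.

Lemma is_derive_affine u (a s x d : R) :
  is_derive (a + s * x) 1 u d -> is_derive x 1 (fun x => u (a + s * x)) (s * d).
Proof.
move=> du; have dl : is_derive x 1 (fun x : R => a + s * x) s.
  by apply: is_derive_eq; rewrite /GRing.scale /=; ring.
by rewrite mulrC; exact: (@is_derive1_comp R u (fun x => a + s * x)  x d s).
Qed.

Lemma smooth_affine u (a s : R) : smooth u -> smooth (fun x => u (a + s * x)).
Proof.
move=> su; pose B := [set w : R -> R | (exists c, w = fun=> c) \/
  exists2 v, smooth v & w = fun x => v (a + s * x)].
apply: (@smooth_function_algebra B); last by apply: alg_base; right; exists u.
move=> _ [[c ->]|[v /smooth_derive[sv dv] ->]].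
  exists (fun=> 0); first by apply: alg_base; left; exists 0.
  by move=> x; exact: is_derive_cst.
exists (fun x => s * derive1 v (a + s * x)).
  apply: (@alg_mul _ (fun=> s) (fun x => derive1 v (a + s * x))); apply: alg_base.
    by left; exists s.
  by right; exists (derive1 v).
by move=> x; exact: is_derive_affine.
Qed.

(** The algebra generated by the smooth functions, u and u' is stable under
differentiation, since u'' = q u. *)
Lemma smooth_schroedinger u u' q : smooth q ->
  (forall x, is_derive x 1 u (u' x)) ->
  (forall x, is_derive x 1 u' (q x * u x)) -> smooth u.
Proof.
move=> sq du du'.
apply: (@smooth_function_algebra [set w | [\/ smooth w, w = u | w = u']]); last first.
  by apply: alg_base; apply: Or32.
move=> b [/smooth_derive[sb db]|->|->].
- by exists (derive1 b) => //; apply: alg_base; apply: Or31.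
- by exists u' => //; apply: alg_base; apply: Or33.
- by exists (fun x => q x * u x) => //; apply: alg_mul; apply: alg_base;
    [apply: Or31|apply: Or32].
Qed.

(** The function x^(- k) e^(- 1 / x) extended by 0 to x <= 0: this family is
stable under differentiation up to linear combinations. *)
Definition flat_exp (k : nat) (x : R) : R :=
  if 0 < x then x ^- k * expR (- x^-1) else 0.

Lemma flat_exp_le0 k x : x <= 0 -> flat_exp k x = 0.
Proof. by rewrite /flat_exp ltNge => ->. Qed.

Lemma flat_exp_gt0 k x : 0 < x -> 0 < flat_exp k x.
Proof.
by move=> x0; rewrite /flat_exp x0 mulr_gt0 ?expR_gt0 // invr_gt0 exprn_gt0.
Qed.

(** From e^y >= y^(k + 2) / (k + 2)! with y = 1 / x; the quadratic bound gives
the derivative at 0. *)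
Lemma flat_exp_small k x : `|flat_exp k x| <= (k.+2)`!%:R * x ^+ 2.
Proof.
rewrite /flat_exp; case: ifPn => x0; last by rewrite normr0 mulr_ge0 ?sqr_ge0.
have xk n : 0 < x ^+ n by exact: exprn_gt0.
have f0 : 0 < (k.+2)`!%:R :> R by rewrite ltr0n fact_gt0.
rewrite ger0_norm ?mulr_ge0 ?invr_ge0 ?expR_ge0 ?(ltW (xk k)) //.
rewrite expRN ler_pdivrMr ?expR_gt0 //.
have h : x^-1 ^+ k.+2 / (k.+2)`!%:R <= expR x^-1.
  have := @expR_ge1Dxn R (x^-1) k.+1; rewrite invr_ge0 => /(_ (ltW x0)); lra.
apply: (@le_trans _ _ ((k.+2)`!%:R * x ^+ 2 * (x^-1 ^+ k.+2 / (k.+2)`!%:R))).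
  rewrite le_eqVlt; apply/orP; left; apply/eqP.
  rewrite exprVn !exprS expr0; field.
  by rewrite !gt_eqF.
by rewrite ler_wpM2l // mulr_ge0 ?ler0n ?sqr_ge0.
Qed.

Lemma is_derive_flat_exp k x :
  is_derive x 1 (flat_exp k) (flat_exp k.+2 x - k%:R * flat_exp k.+1 x).
Proof.
case: (ltgtP x 0) => [x0|x0|->].
- rewrite !flat_exp_le0 ?(ltW x0) // mulr0 subr0.
  apply: (@near_eq_is_derive _ _ _ (cst 0)).
  near=> t; rewrite /= flat_exp_le0 // ltW //.
  by near: t; exact: lt_nbhsl.
- pose g (t : R) := t^-1 ^+ k * expR (- t^-1).
  apply: (@near_eq_is_derive _ _ _ g).
    near=> t; have t0 : 0 < t by near: t; exact: lt_nbhsr.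
    by rewrite /g /flat_exp t0 exprVn.
  have dV : is_derive x 1 (fun t : R => t^-1) (- x ^- 2).
    have := @is_deriveV R id x 1 1 (lt0r_neq0 x0) (is_derive_id _ _).
    by rewrite /GRing.scale /= mulr1.
  have dE : is_derive x 1 (fun t : R => expR (- t^-1)) (x ^- 2 * expR (- x^-1)).
    have dN : is_derive x 1 (fun t : R => - t^-1) (x ^- 2).
      by rewrite -[x ^- 2]opprK; exact: is_deriveN.
    have := @is_derive1_comp R expR (fun t : R => - t^-1) x _ _ (is_derive_expR _) dN.
    by rewrite mulrC.
  have xn0 : x != 0 by rewrite gt_eqF.
  rewrite /flat_exp x0; case: k @g => [|k] g.
    have -> : g = fun t => expR (- t^-1) by apply/funext => t; rewrite /g expr0 mul1r.
    by rewrite mulr0n mul0r subr0.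
  have dX := @is_deriveX R R (fun t : R => t^-1) k.+1 x 1 _ dV.
  have dM := is_deriveM dX dE.
  have -> : g = (fun t : R => t^-1) ^+ k.+1 * (fun t => expR (- t^-1)).
    by apply/funext => t; rewrite /g [RHS]/= -[RHS]/(_ * _) exprfctE.
  apply: (@is_derive_eq _ _ _ _ _ _ _ _ dM).
  rewrite /GRing.scale /= exprfctE !exprVn !exprS; field.
  by rewrite xn0 expf_neq0.
- rewrite !flat_exp_le0 // mulr0 subr0.
  have lim : h^-1 *: (flat_exp k (h *: 1 + 0) - flat_exp k 0) @[h --> 0^'] --> (0 : R).
    pose C : R := (k.+2)`!%:R.
    have C0 : 0 < C by rewrite ltr0n fact_gt0.
    apply/cvgrPdist_le => e e0; rewrite /dnbhs /within /=.
    apply/nbhs_ballP; exists (e / C); first by rewrite /= divr_gt0.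
    move=> h /=; rewrite /ball /= sub0r normrN => hC h0.
    rewrite sub0r normrN (flat_exp_le0 _ (lexx 0)) subr0 addr0 /GRing.scale /= mulr1.
    rewrite normrM normfV ler_pdivrMl ?normr_gt0 //.
    apply: (le_trans (flat_exp_small _ _)).
    rewrite -(real_normK (num_real h)) expr2 mulrCA ler_wpM2l //.
    by rewrite mulrC -ler_pdivlMr // ltW.
  apply: DeriveDef; first by apply/cvg_ex; exists 0.
  exact: cvg_lim.
Unshelve. all: by end_near. Qed.

Lemma smooth_flat_exp k : smooth (flat_exp k).
Proof.
pose B := [set w : R -> R | (exists c, w = fun=> c) \/ exists j, w = flat_exp j].
apply: (@smooth_function_algebra B); last by apply: alg_base; right; exists k.
move=> _ [[c ->]|[j ->]].
  exists (fun=> 0); first by apply: alg_base; left; exists 0.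
  by move=> x; exact: is_derive_cst.
exists (fun x => flat_exp j.+2 x + (- j%:R) * flat_exp j.+1 x); last first.
  by move=> x; have := is_derive_flat_exp j x; rewrite mulNr.
apply: alg_add; first by apply: alg_base; right; exists j.+2.
apply: (@alg_mul _ (fun=> - j%:R) (flat_exp j.+1)); apply: alg_base.
  by left; exists (- j%:R).
by right; exists j.+1.
Qed.

Lemma smooth_continuous u : smooth u -> continuous u.
Proof. by move=> /smooth_derive[_ du] x; exact: (@deriv_continuous R u (derive1 u)). Qed.

Lemma bounded_itv u (a b : R) : continuous u ->
  exists2 M : R, 0 <= M & forall x, a <= x <= b -> `|u x| <= M.
Proof.
move=> cu; case: (leP a b) => ab; last first.
  by exists 0 => // x /andP[ax xb]; move: (le_trans ax xb); rewrite leNgt ab.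
have [c _ cP] := @EVT_max R (fun x => `|u x|) a b ab
  (continuous_subspaceT (fun x => cvg_norm (cu x))).
by exists `|u c| => // x xab; apply: cP; rewrite in_itv.
Qed.

(** The step is the normalized primitive of flat_exp 0 x * flat_exp 0 (1 - x),
which is supported in [0, 1]; the constant M bounds s and its first two
derivatives. *)
Lemma smooth_step : exists M : R, exists s s1 s2 : R -> R,
  [/\ smooth s, forall x, is_derive x 1 s (s1 x), forall x, is_derive x 1 s1 (s2 x)
    & forall x, [/\ `|s x| <= M, `|s1 x| <= M & `|s2 x| <= M] /\
      [/\ x <= 0 -> s x = 0, 1 <= x -> s x = 1 & x <= 0 \/ 1 <= x -> s1 x = 0 /\ s2 x = 0]].
Proof.
pose b x := flat_exp 0 x * flat_exp 0 (1 + (-1) * x).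
pose b' x := flat_exp 2 x * flat_exp 0 (1 + (-1) * x) - flat_exp 0 x * flat_exp 2 (1 + (-1) * x).
have db x : is_derive x 1 b (b' x).
  have d1 := is_derive_flat_exp 0 x; have d2 := is_derive_affine (is_derive_flat_exp 0 (1 + (-1) * x)).
  rewrite /b; apply: is_derive_eq; rewrite /GRing.scale /= /b'; ring.
have sb : smooth b by apply: smoothM; [exact: smooth_flat_exp | apply: smooth_affine; exact: smooth_flat_exp].
have cb' : continuous b'.
  by rewrite -(is_derive_derive1 db); apply: smooth_continuous; have [] := smooth_derive sb.
have cb : continuous b by exact: smooth_continuous.
have out x : x <= 0 \/ 1 <= x -> b x = 0 /\ b' x = 0.
  move=> [x0|x1]; rewrite /b /b'; first by rewrite !(flat_exp_le0 _ x0) !mul0r subr0.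
  by rewrite !(@flat_exp_le0 _ (1 + _)) ?mulr0 ?subr0 //; lra.
have [F F0 dF] := antiderivative 0 cb.
have b0 x : 0 <= b x.
  have f0 y : 0 <= flat_exp 0 y by rewrite /flat_exp; case: ifP => // _; rewrite expr0 invr1 mul1r expR_ge0.
  exact: mulr_ge0.
have Fout x y : (forall t, x <= t <= y -> b t = 0) -> x <= y -> F x = F y.
  move=> bt xy; apply/eqP; rewrite eq_le; apply/andP; split.
    by apply: (@deriv_ge0_le R F b) => // t /bt ->.
  by apply: (@deriv_le0_ge R F b) => // t /bt ->.
have F1 : 0 < F 1.
  have [|c] := @MVT R F b 0 1 ltr01 (fun x _ => dF x).
    by apply: continuous_subspaceT => x; exact: (@deriv_continuous R F b).
  rewrite in_itv /= F0 !subr0 mulr1 => /andP[c0 c1] ->.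
  by rewrite /b mulr_gt0 // flat_exp_gt0 //; lra.
have [M1 M10 M1P] := bounded_itv 0 1 cb; have [M2 M20 M2P] := bounded_itv 0 1 cb'.
pose c := (F 1)^-1; have c0 : 0 < c by rewrite invr_gt0.
exists (1 + c * (M1 + M2)), (fun x => c * F x), (fun x => c * b x), (fun x => c * b' x).
have ds x : is_derive x 1 (fun x => c * F x) (c * b x).
  by have ? := dF x; apply: is_derive_eq; rewrite /GRing.scale /=; ring.
split; [|exact: ds| |].
- have scb : smooth (fun x => c * b x).
    by apply: (@smoothM (fun=> c) b _ sb); exact: smooth_cst.
  exact: (@smooth_primitive (fun x => c * F x) (fun x => c * b x) scb ds).
- move=> x; have ? := db x; apply: is_derive_eq; rewrite /GRing.scale /=; ring.
move=> x.
have s0 : x <= 0 -> F x = 0.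
  move=> x0; rewrite -F0; apply: Fout => // t /andP[_ t0].
  by have [] := out t (or_introl t0).
have s1 : 1 <= x -> F x = F 1.
  move=> x0; apply/esym; apply: Fout => // t /andP[t0 _].
  by have [] := out t (or_intror t0).
split; last first.
  split; first by move=> /s0 ->; rewrite mulr0.
    by move=> /s1 ->; rewrite mulVf // gt_eqF.
  by move=> /out[-> ->]; rewrite mulr0.
have cM1 : 0 <= c * M1 by rewrite mulr_ge0 // ltW.
have cM2 : 0 <= c * M2 by rewrite mulr_ge0 // ltW.
have bd (g : R -> R) (N : R) : 0 <= N -> (forall t, 0 <= t <= 1 -> `|g t| <= N) ->
    (forall t, t <= 0 \/ 1 <= t -> g t = 0) -> `|c * g x| <= c * N.
  move=> N0 gN g0; rewrite normrM (gtr0_norm c0) ler_wpM2l ?(ltW c0) //.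
  case: (leP x 0) => x0; first by rewrite g0 ?normr0 //; left.
  case: (leP 1 x) => x1; first by rewrite g0 ?normr0 //; right.
  by apply: gN; rewrite !ltW.
split.
- apply: (@le_trans _ _ 1); last by lra.
  have mono y z : y <= z -> F y <= F z by move=> yz; exact: (@deriv_ge0_le R F b).
  have c1 : c * F 1 = 1 by rewrite mulVf // gt_eqF.
  rewrite ger0_norm; first case: (leP x 1) => x1.
  + by rewrite -[leRHS]c1 ler_wpM2l ?(ltW c0) // mono.
  + by rewrite (s1 (ltW x1)) c1.
  + rewrite mulr_ge0 ?(ltW c0) //; case: (leP 0 x) => x0; first by rewrite -F0 mono.
    by rewrite s0 // ltW.
- have := bd b M1 M10 M1P (fun t h => proj1 (out t h)); lra.
- have := bd b' M2 M20 M2P (fun t h => proj2 (out t h)); lra.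
Qed.

(** The cutoffs are obtained by translating one step to n + 1 and its mirror
image to - (n + 1), which makes the bounds on the derivatives independent of
n. *)
Lemma cutoffs : exists M : R, exists chi chi1 chi2 : nat -> R -> R, forall n,
  [/\ smooth (chi n), forall x, is_derive x 1 (chi n) (chi1 n x),
      forall x, is_derive x 1 (chi1 n) (chi2 n x)
    & forall x, [/\ `|chi n x| <= M, `|chi1 n x| <= M & `|chi2 n x| <= M] /\
      [/\ `|x| <= n%:R -> [/\ chi n x = 1, chi1 n x = 0 & chi2 n x = 0] &
        n.+1%:R <= `|x| -> chi n x = 0]].
Proof.
have [M [s [s1 [s2 [ss ds ds1 sP]]]]] := smooth_step.
pose A n (x : R) : R := n.+1%:R + (-1) * x; pose B n (x : R) : R := n.+1%:R + 1 * x.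
pose c n x := s (A n x) * s (B n x).
pose c1 n x := - s1 (A n x) * s (B n x) + s (A n x) * s1 (B n x).
pose c2 n x := s2 (A n x) * s (B n x) - 2 * (s1 (A n x) * s1 (B n x))
  + s (A n x) * s2 (B n x).
exists (4 * M ^+ 2), c, c1, c2 => n; split.
- by apply: smoothM; exact: smooth_affine.
- move=> x; have ? := is_derive_affine (ds (A n x)).
  have ? := is_derive_affine (ds (B n x)).
  by rewrite /c; apply: is_derive_eq; rewrite /GRing.scale /= /c1; ring.
- move=> x; have ? := is_derive_affine (ds (A n x)).
  have ? := is_derive_affine (ds (B n x)).
  have ? := is_derive_affine (ds1 (A n x)).
  have ? := is_derive_affine (ds1 (B n x)).
  by rewrite /c1; apply: is_derive_eq; rewrite /GRing.scale /= /c2; ring.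
move=> x.
have [[a0 a1 a2] [A0 A1 Aout]] := sP (A n x).
have [[b0 b1 b2] [B0 B1 Bout]] := sP (B n x).
have M0 : 0 <= M by apply: le_trans b0.
have pr y z : `|y| <= M -> `|z| <= M -> `|y * z| <= M ^+ 2.
  by move=> h1 h2; rewrite normrM expr2 ler_pM.
have M2 : 0 <= M ^+ 2 by rewrite sqr_ge0.
split.
  split.
  - by rewrite /c; have := pr _ _ a0 b0; lra.
  - rewrite /c1 mulNr; apply: (le_trans (ler_normD _ _)); rewrite normrN.
    by have := pr _ _ a1 b0; have := pr _ _ a0 b1; lra.
  - rewrite /c2; apply: (le_trans (ler_normD _ _)).
    have := ler_normB (s2 (A n x) * s (B n x)) (2 * (s1 (A n x) * s1 (B n x))).
    rewrite [`|2 * _|]normrM (ger0_norm (ler0n _ 2)).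
    by have := pr _ _ a2 b0; have := pr _ _ a0 b2; have := pr _ _ a1 b1; lra.
have n1 : n.+1%:R = n%:R + 1 :> R by rewrite -natr1.
split.
  rewrite ler_norml => /andP[x1 x2].
  have hA : 1 <= A n x by rewrite /A n1; lra.
  have hB : 1 <= B n x by rewrite /B n1; lra.
  have [Aout1 Aout2] := Aout (or_intror hA).
  have [Bout1 Bout2] := Bout (or_intror hB).
  by rewrite /c /c1 /c2 A1 // B1 // Aout1 Aout2 Bout1 Bout2; split; ring.
case: (leP 0 x) => x0.
  rewrite ger0_norm // => h; rewrite /c A0 ?mul0r //.
  by rewrite /A; lra.
rewrite ltr0_norm // => h; rewrite /c B0 ?mulr0 //.
by rewrite /B; lra.
Qed.

End SmoothFunctions.

(** * The Pruefer equation *)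

Section Pruefer.
Context {R : realType}.
Implicit Types (k x t a b eta : R) (psi Q V : R -> R).

(** The equation satisfied by the scaled phase psi of a solution u = r sin
psi, u' = k r cos psi. *)
Definition pruefer (k : R) Q psi : Prop :=
  forall x : R, is_derive x 1 psi (k - Q x * sin (psi x) ^+ 2).

Lemma sin_lip a b : `|sin a - sin b| <= `|a - b|.
Proof.
have h := @deriv_dist_le R sin id cos (fun=> 1) b a (@is_derive_sin R).
by apply: h => x; rewrite ler_norml cos_geN1 cos_le1.
Qed.

Lemma sin_norm a : `|sin a| <= 1.
Proof. by rewrite ler_norml sin_geN1 sin_le1. Qed.

Lemma sin_sqr_le1 a : 0 <= sin a ^+ 2 <= 1.
Proof. by rewrite sqr_ge0 -(real_normK (num_real _)) exprn_ile1 ?sin_norm. Qed.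

Lemma sin_sqr_lip a b : `|sin a ^+ 2 - sin b ^+ 2| <= 2 * `|a - b|.
Proof.
rewrite subr_sqr normrM mulrC ler_pM //; last exact: sin_lip.
by apply: (le_trans (ler_normD _ _)); have := sin_norm a; have := sin_norm b; lra.
Qed.

Lemma sin_sqr_period a (j : nat) : sin (a + j%:R * pi) ^+ 2 = sin a ^+ 2.
Proof.
elim: j => [|j IH]; first by rewrite mul0r addr0.
by rewrite -natr1 mulrDl mul1r addrA sinDpi sqrrN.
Qed.

Lemma sin_sqr_npi (j : nat) : sin (j%:R * pi : R) ^+ 2 = 0.
Proof. by rewrite -[_ * _]add0r sin_sqr_period sin0 expr0n. Qed.

Lemma pruefer_exists k Q (x0 y0 : R) : continuous Q ->
  exists2 psi : R -> R, psi x0 = y0 & pruefer k Q psi.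
Proof.
move=> cQ.
apply: (@ode_exists R (fun x a => k - Q x * sin a ^+ 2) (fun x => `|k| + 2 * `|Q x|)).
- move=> x; apply: cvgD; first exact: cvg_cst.
  by apply: cvgM; [exact: cvg_cst | apply: cvg_norm; exact: cQ].
- move=> x a; apply: (le_trans (ler_normB _ _)); rewrite lerD2l normrM.
  have /andP[s0 s1] := sin_sqr_le1 a; rewrite (ger0_norm s0).
  by have := normr_ge0 (Q x); nra.
- move=> x a b.
  have -> : k - Q x * sin a ^+ 2 - (k - Q x * sin b ^+ 2) =
    - (Q x * (sin a ^+ 2 - sin b ^+ 2)) by ring.
  rewrite normrN normrM.
  have h1 : `|Q x| * `|sin a ^+ 2 - sin b ^+ 2| <= `|Q x| * (2 * `|a - b|).
    by rewrite ler_wpM2l // sin_sqr_lip.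
  have h2 : 0 <= `|k| * `|a - b| by rewrite mulr_ge0.
  by rewrite mulrDl; lra.
- move=> y cy x; apply: cvgB; first exact: cvg_cst.
  apply: cvgM; first exact: cQ.
  have cs : {for x, continuous (fun x => sin (y x))}.
    by apply: continuous_comp; [exact: cy | exact: continuous_sin].
  rewrite expr2; under eq_fun do rewrite expr2.
  exact: (cvgM cs cs).
Qed.

(** Continuous dependence on both the initial value and the coefficient; the
constant K depends on neither psi1, psi2 nor Q2. *)
Lemma pruefer_dependence Q a b : continuous Q ->
  exists2 K : R, 0 <= K & forall k Q2 psi1 psi2 eta, 0 <= eta ->
    pruefer k Q psi1 -> pruefer k Q2 psi2 -> (forall x, `|Q x - Q2 x| <= eta) ->
    (psi1 b - psi2 b) ^+ 2 <= K * ((psi1 a - psi2 a) ^+ 2 + eta ^+ 2).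
Proof.
move=> cQ; pose p x := 1 + 2 * `|Q x|.
have cp : continuous p.
  move=> x; apply: cvgD; first exact: cvg_cst.
  by apply: cvgM; [exact: cvg_cst | apply: cvg_norm; exact: cQ].
have [P _ dP] := antiderivative a cp.
exists (expR (3 * `|P b - P a|)); first exact: expR_ge0.
move=> k Q2 psi1 psi2 eta eta0 d1 d2 QQ.
have := @gronwall R (psi1 - psi2)
  (fun x => (k - Q x * sin (psi1 x) ^+ 2) - (k - Q2 x * sin (psi2 x) ^+ 2)) p P eta a b.
rewrite !fctE => H; rewrite mulrC; apply: le_trans (H _ _ dP _).
- by rewrite lerDl sqr_ge0.
- by move=> x; rewrite /p; have := normr_ge0 (Q x); lra.
- by move=> x; have ? := d1 x; have ? := d2 x; exact: is_deriveB.
move=> x.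
have -> : k - Q x * sin (psi1 x) ^+ 2 - (k - Q2 x * sin (psi2 x) ^+ 2) =
   - (Q x * (sin (psi1 x) ^+ 2 - sin (psi2 x) ^+ 2) + (Q x - Q2 x) * sin (psi2 x) ^+ 2) by ring.
rewrite normrN; apply: (le_trans (ler_normD _ _)); rewrite (normrM (Q x)) (normrM (Q x - Q2 x)) (ger0_norm eta0).
have h1 : `|Q x| * `|sin (psi1 x) ^+ 2 - sin (psi2 x) ^+ 2| <=
    `|Q x| * (2 * `|psi1 x - psi2 x|) by rewrite ler_wpM2l // sin_sqr_lip.
have h2 : `|Q x - Q2 x| * `|sin (psi2 x)^+2| <= eta.
  have /andP[s0 s1] := sin_sqr_le1 (psi2 x); rewrite (ger0_norm s0).
  by rewrite -[leRHS]mulr1 ler_pM.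
have h3 : 0 <= `|Q x| * eta by rewrite mulr_ge0.
have h4 := normr_ge0 (psi1 x - psi2 x).
by rewrite /p mulrDl mul1r mulrDr; lra.
Qed.

Lemma pruefer_unique k Q psi1 psi2 a : continuous Q ->
  pruefer k Q psi1 -> pruefer k Q psi2 -> psi1 a = psi2 a -> psi1 = psi2.
Proof.
move=> cQ d1 d2 e; apply/funext => b.
have [K K0 HK] := pruefer_dependence a b cQ.
have := HK k Q psi1 psi2 0 (lexx 0) d1 d2.
rewrite e !subrr expr0n addr0 mulr0 => /(_ _) h.
apply/eqP; rewrite -subr_eq0 -sqrf_eq0 eq_le sqr_ge0 andbT.
by apply: h => x; rewrite subrr normr0.
Qed.

(** At a multiple of pi the sine vanishes and the angle increases with speed
k. *)
Lemma pruefer_ge k Q psi a b (j : nat) : 0 < k -> pruefer k Q psi -> a <= b ->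
  j%:R * pi <= psi a -> j%:R * pi <= psi b.
Proof.
move=> k0 d ab; rewrite -subr_ge0 => h; rewrite -subr_ge0.
apply: (@barrier R (fun x => psi x - j%:R * pi) (fun x => k - Q x * sin (psi x) ^+ 2) a b ab _ h).
  move=> x; have ? := d x; rewrite -[X in is_derive _ _ _ X]subr0.
  exact: is_deriveB.
by move=> x _ /eqP; rewrite subr_eq0 => /eqP ->; rewrite sin_sqr_npi mulr0 subr0.
Qed.

(** At pi / 2 the angle has speed k - Q < 0. *)
Lemma pruefer_le_half k Q psi a b : pruefer k Q psi -> a <= b ->
  (forall x, a <= x <= b -> k < Q x) -> psi a <= pi / 2 -> psi b <= pi / 2.
Proof.
move=> d ab kQ; rewrite -subr_ge0 => h; rewrite -subr_ge0.
apply: (@barrier R (fun x => pi / 2 - psi x) (fun x => - (k - Q x * sin (psi x) ^+ 2)) a b ab _ h).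
  move=> x; have ? := d x; rewrite -[X in is_derive _ _ _ X]sub0r.
  exact: is_deriveB.
move=> x xab /eqP; rewrite subr_eq0 => /eqP <-; rewrite sin_pihalf expr1n mulr1.
by have := kQ x xab; lra.
Qed.

(** This symmetry transfers every statement about the left end to the right
end, where the angle ends at j pi instead of starting at 0. *)
Lemma pruefer_reflect k Q psi (j : nat) : pruefer k Q psi ->
  pruefer k (fun x => Q (- x)) (fun x => j%:R * pi - psi (- x)).
Proof.
move=> d x.
have -> : sin (j%:R * pi - psi (- x)) ^+ 2 = sin (psi (- x)) ^+ 2.
  by rewrite addrC sin_sqr_period sinN sqrrN.
have dpsi := d (- x); have dN := is_deriveNid x (1 : R).
have dc := @is_derive1_comp R psi -%R x _ _ dpsi dN.
apply: is_derive_eq; rewrite /GRing.scale /=; ring.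
Qed.

Lemma pruefer_growth k Q psi a b : pruefer k Q psi -> a <= b ->
  (forall x, a <= x <= b -> Q x <= 0) -> k * (b - a) <= psi b - psi a.
Proof.
move=> d ab Q0.
have dk (x : R) : is_derive x 1 (fun x => k * x) k.
  by apply: is_derive_eq; rewrite /GRing.scale /=; ring.
rewrite mulrBr; apply: (@deriv_le_le R (fun x => k * x) psi (fun=> k) _ a b ab) => [x _|x xab].
- exact: d.
- by have := Q0 x xab; have /andP[s0 _] := sin_sqr_le1 (psi x); nra.
Qed.

(** With this coefficient the Pruefer equation is the phase equation of - u''
+ V u = E u; it exceeds k exactly where V > E. *)
Definition pruefer_coef (k : R) V (E : R) : R -> R := fun x => (k ^+ 2 + V x - E) / k.

Lemma continuous_pruefer_coef k V E : continuous V -> continuous (pruefer_coef k V E).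
Proof.
move=> cV x; apply: cvgM; last exact: cvg_cst.
by apply: cvgB; [apply: cvgD; [exact: cvg_cst | exact: cV] | exact: cvg_cst].
Qed.

Lemma pruefer_coef_gt k V E x : 0 < k -> E < V x -> k < pruefer_coef k V E x.
Proof. by move=> k0 EV; rewrite /pruefer_coef ltr_pdivlMr // -expr2; lra. Qed.

Lemma pruefer_coef_dist k V E E' x : 0 < k -> `|pruefer_coef k V E x - pruefer_coef k V E' x| = `|E - E'| / k.
Proof.
move=> k0; rewrite /pruefer_coef -mulrBl normrM normfV (gtr0_norm k0) distrC; congr (`|_| / _); ring.
Qed.

(** Start with angle 0 at - T and watch the angle at T as a function of E. At
E0, below the potential, it is at most pi / 2; at E1 it has grown by at least
2 k L on [- L, L] and cannot go back below j pi afterwards. Continuity in E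
does the rest. *)
Lemma shooting k V (E0 E1 L T : R) (j : nat) : continuous V -> 0 < k ->
  (forall x, E0 < V x) -> 0 <= L -> L <= T ->
  (forall x, - L <= x <= L -> V x <= E1 - k ^+ 2) ->
  (0 < j)%N -> j%:R * pi <= 2 * k * L ->
  exists E psi, [/\ E0 <= E <= E1, pruefer k (pruefer_coef k V E) psi,
     psi (- T) = 0 & psi T = j%:R * pi].
Proof.
move=> cV k0 E0V L0 LT VE1 j0 jL.
have /choice[Psi PsiP] : forall E, exists psi : R -> R, psi (- T) = 0 /\ pruefer k (pruefer_coef k V E) psi.
  move=> E; have [psi h1 h2] := @pruefer_exists k _ (- T) 0 (@continuous_pruefer_coef k V E cV).
  by exists psi.
have E01 : E0 <= E1.
  have := VE1 0; have := E0V 0; have := sqr_ge0 k.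
  by rewrite oppr_le0 L0 => h1 h2 /(_ isT); lra.
have cont : continuous (fun E => Psi E T).
  move=> E; have [K K0 HK] := pruefer_dependence (- T) T (@continuous_pruefer_coef k V E cV).
  have bd E' : `|Psi E T - Psi E' T| ^+ 2 <= (K + 1) * (`|E - E'| / k) ^+ 2.
    have [e1 p1] := PsiP E; have [e2 p2] := PsiP E'.
    have eta0 : 0 <= `|E - E'| / k by rewrite divr_ge0 // ltW.
    have := HK k _ _ _ _ eta0 p1 p2 (fun x => _ : _ <= _).
    rewrite e1 e2 subrr expr0n add0r real_normK ?num_real // => h.
    rewrite mulrDl mul1r (le_trans (h _)) ?lerDl ?sqr_ge0 // => x.
    by rewrite pruefer_coef_dist.
  apply/cvgrPdist_lt => e e0.
  pose c := Num.sqrt (K + 1) / k.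
  have c0 : 0 < c by rewrite divr_gt0 // sqrtr_gt0; lra.
  apply/nbhs_ballP; exists (e / c); first by rewrite /= divr_gt0.
  move=> E' /=; rewrite /ball /= ltr_pdivlMr // => h.
  apply: le_lt_trans h; rewrite -(@ler_pXn2r _ 2) ?nnegrE //; last by rewrite mulr_ge0 // ltW.
  apply: (le_trans (bd E')); rewrite le_eqVlt; apply/orP; left; apply/eqP.
  rewrite /c !exprMn sqr_sqrtr; last by lra.
  by ring.
have pi0 := pi_gt0 R.
have lowE : Psi E0 T <= j%:R * pi.
  have [e p] := PsiP E0.
  have : Psi E0 T <= pi / 2.
    apply: (pruefer_le_half p (_ : - T <= T)); first by lra.
      by move=> x _; exact: pruefer_coef_gt.
    by rewrite e divr_ge0 // ltW.
  have : 1 <= j%:R :> R by rewrite ler1n.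
  by nra.
have highE : j%:R * pi <= Psi E1 T.
  have [e p] := PsiP E1.
  apply: (pruefer_ge k0 p LT).
  have : 0%N%:R * pi <= Psi E1 (- L).
    apply: (pruefer_ge k0 p (_ : - T <= - L)); first by lra.
    by rewrite e mul0r.
  have := pruefer_growth p (_ : - L <= L) => /(_ _ _) h.
  have {h} : k * (L - - L) <= Psi E1 L - Psi E1 (- L).
    apply: h; first by lra.
    move=> x /VE1 h; rewrite /pruefer_coef mulr_le0_ge0 ?invr_ge0 ?(ltW k0) //; lra.
  by rewrite mul0r; lra.
have [|E] := @IVT R (fun E => Psi E T) E0 E1 (j%:R * pi) E01 (continuous_subspaceT cont).
  by rewrite ge_min lowE /= le_max highE orbT.
rewrite in_itv /= => EE e; have [e1 p] := PsiP E.
by exists E, (Psi E).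
Qed.

End Pruefer.

(** * Bound states as limits of Dirichlet problems *)

Section BoundStates.
Context {R : realType}.
Implicit Types (k E L T X x t a b e : R) (psi Q V : R -> R).

(** Encodes the decay of u at both ends through signs only: modulo pi the
angle lies in the quadrant where u and u' have the same sign on the left, and
opposite signs on the right. The integer j records the number of half turns.
*)
Definition decaying_angle (X0 : R) (j : nat) psi : Prop :=
  (forall x, x <= - X0 -> 0 <= psi x <= pi / 2) /\
  (forall x, X0 <= x -> j%:R * pi - pi / 2 <= psi x <= j%:R * pi).

Lemma pruefer_left k Q psi T X0 : 0 < k -> pruefer k Q psi ->
  (forall x, x <= - X0 -> k < Q x) -> psi (- T) = 0 ->
  forall x, - T <= x -> x <= - X0 -> 0 <= psi x <= pi / 2.
Proof.
move=> k0 d kQ psi0 x Tx xX; have pi0 := pi_gt0 R.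
apply/andP; split.
  have := @pruefer_ge _ _ _ _ _ _ 0 k0 d Tx; rewrite !mul0r => -> //.
  by rewrite psi0.
apply: (pruefer_le_half d Tx); last by rewrite psi0; lra.
by move=> t /andP[_ tx]; apply: kQ; exact: le_trans xX.
Qed.

(** The Dirichlet solutions on [- T, T] satisfy the angle conditions wherever
they make sense, with X0 independent of T. Energies and angles at - X0 stay in
a compact set; by continuous dependence the solution issued from a cluster
point inherits the conditions at every x. *)
Lemma bound_state_angle k V E0 E1 L X0 (j : nat) : continuous V -> 0 < k ->
  (forall x, E0 < V x) -> 0 <= L -> 0 <= X0 ->
  (forall x, - L <= x <= L -> V x <= E1 - k ^+ 2) ->
  (forall x, X0 <= `|x| -> E1 < V x) ->
  (0 < j)%N -> j%:R * pi <= 2 * k * L ->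
  exists E psi, [/\ E0 <= E <= E1, pruefer k (pruefer_coef k V E) psi &
     decaying_angle X0 j psi].
Proof.
move=> cV k0 E0V L0 X00 VE1 E1V j0 jL.
pose T (m : nat) : R := L + X0 + m%:R.
have /choice[Ep] : forall m, exists Ep : R * (R -> R),
    [/\ E0 <= Ep.1 <= E1, pruefer k (pruefer_coef k V Ep.1) Ep.2,
     Ep.2 (- T m) = 0 & Ep.2 (T m) = j%:R * pi].
  move=> m; have LT : L <= T m by rewrite /T; have := ler0n R m; lra.
  have [E [psi h]] := shooting cV k0 E0V L0 LT VE1 j0 jL.
  by exists (E, psi).
pose E_ m := (Ep m).1; pose psi_ m := (Ep m).2 => EpP.
have decay m x : `|x| <= T m -> (x <= - X0 -> 0 <= psi_ m x <= pi / 2) /\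
    (X0 <= x -> j%:R * pi - pi / 2 <= psi_ m x <= j%:R * pi).
  rewrite ler_norml => /andP[Tx xT]; have [/andP[_ EE1] d e0 e1] := EpP m.
  split=> xX.
    apply: (@pruefer_left k _ _ (T m) X0 k0 d) => // t tX.
    apply: pruefer_coef_gt => //; apply: (le_lt_trans EE1); apply: E1V.
    by rewrite ler0_norm; lra.
  have := @pruefer_left k _ _ (T m) X0 k0 (pruefer_reflect j d) _ _ (- x).
  rewrite !opprK e1 subrr lerN2 lerNl opprK => h.
  have : 0 <= j%:R * pi - psi_ m x <= pi / 2.
    apply: h => //.
    move=> t tX; apply: pruefer_coef_gt => //; apply: (le_lt_trans EE1); apply: E1V.
    by rewrite normrN ler0_norm; lra.
  by move=> /andP[h1 h2]; apply/andP; split; lra.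
pose a_ m := psi_ m (- X0).
have T0 m : X0 <= T m by rewrite /T; have := ler0n R m; lra.
have cK := compact_setX (@segment_compact R E0 E1) (@segment_compact R 0 (pi / 2)).
have [[E a] [[/= Eb _] clus]] : exists p : R * R, (`[E0, E1]%classic `*` `[0, pi / 2]%classic) p /\
    cluster ((fun m => (E_ m, a_ m)) @ \oo) p.
  have [|p [Kp cp]] := cK ((fun m => (E_ m, a_ m)) @ \oo) _; last by exists p.
  exists 0%N => // m _ /=; split=> /=; rewrite in_itv /=.
    by have [] := EpP m.
  have [|h _] := decay m (- X0); first by rewrite normrN ger0_norm.
  exact: h.
have [psi psia dpsi] := @pruefer_exists R k _ (- X0) a (@continuous_pruefer_coef _ k V E cV).
have {}Eb : E0 <= E <= E1 by move: Eb; rewrite in_itv /=.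
exists E, psi; split; [exact: Eb | exact: dpsi |].
have approx x e (N : nat) : 0 < e ->
    exists2 m, (N <= m)%N & `|psi x - psi_ m x| <= e.
  move=> e0.
  have [K K0 HK] := pruefer_dependence (- X0) x (@continuous_pruefer_coef _ k V E cV).
  (* the coefficients at energies E and E' differ by |E - E'| / k *)
  pose d := e / (Num.sqrt (K + 1) * (1 + k^-1)).
  have ki0 : 0 < k^-1 by rewrite invr_gt0.
  have s0 : 0 < Num.sqrt (K + 1) by rewrite sqrtr_gt0; lra.
  have d0 : 0 < d by rewrite divr_gt0 // mulr_gt0 //; lra.
  have bnear : nbhs ((E, a) : R * R) (ball ((E, a) : R * R) d) by exact: nbhsx_ballx.
  have tail : ((fun m => (E_ m, a_ m)) @ \oo)
      [set (E_ m, a_ m) | m in [set m | (N <= m)%N]].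
    by exists N => // m /= Nm; exists m.
  have [_ [[m Nm <-] [bE ba]]] := clus _ _ tail bnear.
  exists m => //.
  have [_ dm _ _] := EpP m.
  have eta0 : 0 <= `|E - E_ m| / k by rewrite divr_ge0 // ltW.
  have := HK k _ _ _ _ eta0 dpsi dm (fun x => _ : _ <= _).
  rewrite psia => /(_ _) h.
  have {h} h : (psi x - psi_ m x) ^+ 2 <= K * ((a - a_ m) ^+ 2 + (`|E - E_ m| / k) ^+ 2).
    by apply: h => t; rewrite pruefer_coef_dist.
  move: bE ba; rewrite /ball /= => bE ba.
  rewrite -(@ler_pXn2r _ 2) ?nnegrE ?(ltW e0) // real_normK ?num_real //.
  apply: (le_trans h).
  have -> : e = Num.sqrt (K + 1) * (d * (1 + k^-1)).
    by rewrite /d; field; rewrite !gt_eqF //; lra.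
  rewrite [leRHS]exprMn sqr_sqrtr; last by lra.
  apply: ler_pM => //; first by rewrite addr_ge0 ?sqr_ge0.
    by lra.
  rewrite mulrDr mulr1.
  have h1 : (a - a_ m) ^+ 2 <= d ^+ 2.
    by rewrite -(real_normK (num_real (a - a_ m))) ler_pXn2r ?nnegrE ?(ltW d0) // ltW.
  have h2 : (`|E - E_ m| / k) ^+ 2 <= (d * k^-1) ^+ 2.
    rewrite ler_pXn2r ?nnegrE //; last by rewrite mulr_ge0 // ltW.
    by rewrite ler_wpM2r ?ltW.
  have h3 : 0 <= d * (d * k^-1) by apply: mulr_ge0; [|apply: mulr_ge0]; exact: ltW.
  have -> : (d + d * k^-1) ^+ 2 = d ^+ 2 + (d * k^-1) ^+ 2 + 2 * (d * (d * k^-1)) by ring.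
  lra.
have big x : exists N : nat, forall m, (N <= m)%N -> `|x| <= T m.
  exists (Num.truncn `|x|).+1 => m Nm.
  have := truncnS_gt `|x|; have : (Num.truncn `|x|).+1%:R <= m%:R :> R by rewrite ler_nat.
  by rewrite /T; lra.
split=> x xX; have [N NP] := big x.
  apply/andP; split; apply/ler_addgt0Pr => e e0; have [m Nm] := approx x e N e0;
    have [/(_ xX) h _] := decay m x (NP m Nm); rewrite ler_norml; move: h; lra.
apply/andP; split; apply/ler_addgt0Pr => e e0; have [m Nm] := approx x e N e0;
  have [_ /(_ xX) h] := decay m x (NP m Nm); rewrite ler_norml; move: h; lra.
Qed.

(** sin^2 b - sin^2 a = sin (b + a) sin (b - a), and sin (b + a) - sin (b - a)
= 2 cos b sin a >= 0. *)
Lemma sin_sqr_sub a b : 0 <= a <= pi / 2 -> 0 <= b <= pi / 2 -> a <= b ->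
  sin (b - a) ^+ 2 <= sin b ^+ 2 - sin a ^+ 2.
Proof.
have pi0 := pi_gt0 R.
move=> /andP[a0 a1] /andP[h0 h1] ab.
have sa : 0 <= sin a by apply: sin_ge0_pi; apply/andP; split; lra.
have cb : 0 <= cos b by apply: cos_ge0_pihalf; apply/andP; split; lra.
have sd : 0 <= sin (b - a) by apply: sin_ge0_pi; apply/andP; split; lra.
have e : sin b ^+ 2 - sin a ^+ 2 = sin (b + a) * sin (b - a).
  rewrite sinD sinB.
  have := cos2Dsin2 a; have := cos2Dsin2 b.
  move: (cos a) (sin a) (cos b) (sin b) => ca sa' cb' sb h2 h3.
  have -> : (sb * ca + cb' * sa') * (sb * ca - cb' * sa') = sb ^+ 2 * ca ^+ 2 - cb' ^+ 2 * sa' ^+ 2 by ring.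
  have -> : ca ^+ 2 = 1 - sa' ^+ 2 by lra.
  have -> : cb' ^+ 2 = 1 - sb ^+ 2 by lra.
  ring.
rewrite e expr2 ler_wpM2r // (sinD b a) (sinB b a).
by have := mulr_ge0 cb sa; lra.
Qed.

(** The square of the difference D of two such angles has derivative at most -
2 k |D| sin^2 |D|. If D did not vanish at - X0, D^2 would therefore grow at
least linearly towards - oo, whereas it is bounded by (pi / 2)^2. *)
Lemma left_angle_unique k Q psi1 psi2 X0 : 0 < k -> continuous Q ->
  pruefer k Q psi1 -> pruefer k Q psi2 ->
  (forall x, x <= - X0 -> k < Q x) ->
  (forall x, x <= - X0 -> 0 <= psi1 x <= pi / 2) ->
  (forall x, x <= - X0 -> 0 <= psi2 x <= pi / 2) -> psi1 = psi2.
Proof.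
move=> k0 cQ d1 d2 kQ b1 b2; have pi0 := pi_gt0 R.
apply: (@pruefer_unique _ k Q _ _ (- X0) cQ d1 d2); apply/eqP/negPn/negP => ne.
pose D x := psi2 x - psi1 x.
pose D' x := - (Q x * (sin (psi2 x) ^+ 2 - sin (psi1 x) ^+ 2)).
have dD (x : R) : is_derive x 1 (fun x => D x ^+ 2) (2 * (D x * D' x)).
  have ? := d1 x; have ? := d2 x; rewrite /D.
  by apply: is_derive_eq; rewrite /GRing.scale /= /D'; ring.
pose d0 : R := `|D (- X0)|.
have d00 : 0 < d0 by rewrite normr_gt0 subr_eq0 eq_sym.
have DD' x : x <= - X0 -> D x * D' x <= - (k * (`|D x| * sin `|D x| ^+ 2)).
  move=> xX; have p1 := b1 x xX; have p2 := b2 x xX; have q := kQ x xX.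
  rewrite /D /D'.
  case: (leP (psi1 x) (psi2 x)) => h.
    rewrite ger0_norm ?subr_ge0 //.
    have := sin_sqr_sub p1 p2 h; have : 0 <= psi2 x - psi1 x by lra.
    have := sqr_ge0 (sin (psi2 x - psi1 x)).
    move: (psi2 x - psi1 x) (sin (psi2 x) ^+ 2 - _) => u v s0 u0 sv.
    rewrite mulrN lerN2.
    have h1 : k * (sin u ^+ 2) <= Q x * v by rewrite ler_pM // ltW.
    have h2 := ler_wpM2l u0 h1; rewrite mulrCA; exact: h2.
  rewrite ltr0_norm ?subr_lt0 // opprB.
  have := sin_sqr_sub p2 p1 (ltW h); have : 0 <= psi1 x - psi2 x by lra.
  have := sqr_ge0 (sin (psi1 x - psi2 x)).
  have -> : (psi2 x - psi1 x) * - (Q x * (sin (psi2 x) ^+ 2 - sin (psi1 x) ^+ 2))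
     = - ((psi1 x - psi2 x) * (Q x * (sin (psi1 x) ^+ 2 - sin (psi2 x) ^+ 2))) by ring.
  move: (psi1 x - psi2 x) (sin (psi1 x) ^+ 2 - _) => u v s0 u0 sv.
  rewrite lerN2.
  have h1 : k * (sin u ^+ 2) <= Q x * v by rewrite ler_pM // ltW.
  have h2 := ler_wpM2l u0 h1; rewrite mulrCA; exact: h2.
have Dhalf x : x <= - X0 -> `|D x| <= pi / 2.
  move=> xX; have /andP[? ?] := b1 x xX; have /andP[? ?] := b2 x xX.
  by rewrite /D ler_norml; apply/andP; split; lra.
have Dlow x : x <= - X0 -> d0 <= `|D x|.
  move=> xX; rewrite /d0 -(@ler_pXn2r _ 2) ?nnegrE // !real_normK ?num_real //.
  apply: (@deriv_le0_ge R (fun x => D x ^+ 2) _ _ _ xX (fun x _ => dD x)).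
  move=> t /andP[_ tX]; have := DD' t tX.
  have : 0 <= k * (`|D t| * sin `|D t| ^+ 2) by apply: mulr_ge0; [exact: ltW | apply: mulr_ge0 => //; exact: sqr_ge0].
  lra.
pose c := 2 * (k * (d0 * sin d0 ^+ 2)).
have sd0 : 0 < sin d0.
  by apply: sin_gt0_pi; rewrite d00 /=; have := Dhalf _ (lexx (- X0)); rewrite -/d0; lra.
have c0 : 0 < c.
  by do 3! (apply: mulr_gt0 => //); exact: exprn_gt0.
(* far enough to the left for D^2 to exceed pi^2 *)
pose x := - X0 - (pi ^+ 2) / c.
have xX : x <= - X0 by rewrite /x gerBl divr_ge0 ?sqr_ge0 ?ltW.
have lin (y : R) : is_derive y 1 (fun y => - c * y) (- c).
  by apply: is_derive_eq; rewrite /GRing.scale /=; ring.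
have := @deriv_le_le R (fun x => D x ^+ 2) (fun y => - c * y) _ (fun=> - c) _ _ xX (fun x _ => dD x) (fun x _ => lin x).
have -> : - c * - X0 - - c * x = - pi ^+ 2 by rewrite /x; field; rewrite gt_eqF.
move=> H; have {H} : D (- X0) ^+ 2 - D x ^+ 2 <= - pi ^+ 2.
  apply: H => t /andP[_ tX]; have := DD' t tX.
  have h1 := Dlow t tX; have h2 := Dhalf t tX.
  have : sin d0 <= sin `|D t|.
    have h3 := Dhalf _ (lexx (- X0)); rewrite -/d0 in h3.
    rewrite leNgt ltr_sin ?in_itv /=; first by rewrite -leNgt.
      by apply/andP; split; lra.
    by apply/andP; split; lra.
  move=> h4.
  have h5 : sin d0 ^+ 2 <= sin `|D t| ^+ 2 by rewrite ler_pXn2r ?nnegrE ?(ltW sd0) // (le_trans (ltW sd0)).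
  have : k * (d0 * sin d0 ^+ 2) <= k * (`|D t| * sin `|D t| ^+ 2).
    by rewrite ler_wpM2l ?(ltW k0) // ler_pM ?sqr_ge0 ?(ltW d00).
  rewrite /c; lra.
have := Dhalf x xX; rewrite -(@ler_pXn2r _ 2) ?nnegrE //; last by lra.
rewrite real_normK ?num_real //; have := sqr_ge0 (D (- X0)).
have : (pi / 2) ^+ 2 < pi ^+ 2 :> R by have := exprn_gt0 2 pi0; lra.
lra.
Qed.

(** Equal energies force equal angles by uniqueness on the left, and an angle
cannot lie at X0 in two of the disjoint intervals [j pi - pi / 2, j pi]. *)
Lemma bound_state_unique k V E X0 psi1 psi2 (j1 j2 : nat) : 0 < k -> continuous V ->
  (forall x, X0 <= `|x| -> E < V x) -> 0 <= X0 ->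
  pruefer k (pruefer_coef k V E) psi1 -> pruefer k (pruefer_coef k V E) psi2 ->
  decaying_angle X0 j1 psi1 -> decaying_angle X0 j2 psi2 -> j1 = j2.
Proof.
move=> k0 cV EV X00 d1 d2 [l1 r1] [l2 r2]; have pi0 := pi_gt0 R.
have e : psi1 = psi2.
  apply: (@left_angle_unique k _ _ _ X0 k0 (@continuous_pruefer_coef _ k V E cV) d1 d2 _ l1 l2).
  by move=> x xX; apply: pruefer_coef_gt => //; apply: EV; rewrite ler0_norm; lra.
have {r1} := r1 _ (lexx X0); have {r2} := r2 _ (lexx X0); rewrite e.
wlog : j1 j2 / (j1 < j2)%N => [H|j12].
  by move=> h1 h2; case: (ltngtP j1 j2) => // h; [exact: H h h1 h2 | apply/esym; exact: H h h2 h1].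
have : j1%:R + 1 <= j2%:R :> R by rewrite natr1 ler_nat.
move=> h /andP[h1 h2] /andP[h3 h4]; exfalso; clear j12.
have := ler_wpM2r (ltW pi0) h; rewrite mulrDl mul1r; lra.
Qed.

End BoundStates.

(** * From the angle to a square-integrable solution *)

Section Integrals.
Context {R : realType}.
Local Notation mu := (@lebesgue_measure R).

Lemma integral_itv_antiderivative (h H : R -> R) (a b : R) : a < b -> continuous h ->
  (forall x : R, is_derive x 1 H (h x)) ->
  (\int[mu]_(x in `[a, b]) (h x)%:E = (H b - H a)%:E)%E.
Proof.
move=> ab ch dH; rewrite EFinB; apply: continuous_FTC2 => //.
- exact: continuous_subspaceT.
- have cH : continuous H by move=> x; exact: (@deriv_continuous R H h).
  split.
  + by move=> x _; have [] := dH x.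
  + by apply: cvg_at_right_filter; exact: cH.
  + by apply: cvg_at_left_filter; exact: cH.
- by move=> x _; have [_ <-] := dH x; rewrite derive1E.
Qed.

Lemma continuous_measurable (h : R -> R) (D : set R) : measurable D -> continuous h ->
  measurable_fun D h.
Proof.
move=> mD ch; apply: (@measurable_funS _ _ _ _ setT) => //.
by apply: open_continuous_measurable_fun; [exact: openT | move=> x _; exact: ch].
Qed.

(** Monotone convergence along [- n, n], with the integral on each interval
given by a primitive. *)
Lemma integral_setT_le (h : R -> R) (B : R) : continuous h -> (forall x, 0 <= h x) ->
  (forall H : R -> R, (forall x : R, is_derive x 1 H (h x)) ->
    forall r : R, 0 < r -> H r - H (- r) <= B) ->
  (\int[mu]_x (h x)%:E <= B%:E)%E.
Proof.
move=> ch h0 HB.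
have [H _ dH] := antiderivative 0 ch.
pose F (n : nat) : set R := `[- n.+1%:R, n.+1%:R]%classic.
have UF : \bigcup_i F i = setT.
  rewrite -subTset => x _; exists (Num.truncn `|x|) => //.
  rewrite /F /= in_itv /= -ler_norml ltW //; exact: truncnS_gt.
have mh i : measurable_fun (F i) (EFin \o h).
  by apply/measurable_EFinP; apply: continuous_measurable => //; exact: measurable_itv.
rewrite -UF; apply: (@cvge_le _ \oo _ R (fun i => \int[mu]_(x in F i) (h x)%:E)%E).
  apply: nearW => n; rewrite (@integral_itv_antiderivative h H) //; last first.
    by rewrite gtrN.
  by rewrite lee_fin; exact: HB.
apply: ge0_nondecreasing_set_cvg_integral => //.
- move=> n m nm; rewrite /F subsetEset; apply: subset_itv; rewrite bnd_simp.
    by rewrite lerN2 ler_nat.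
  by rewrite ler_nat.
- by move=> i; exact: measurable_itv.
- by move=> i x _; rewrite lee_fin.
Qed.

Lemma integral_setT_lty (h g G : R -> R) (B : R) : continuous h -> (forall x, 0 <= h x) ->
  (forall x : R, is_derive x 1 G (g x)) -> (forall x, h x <= g x) ->
  (forall x, `|G x| <= B) -> (\int[mu]_x (h x)%:E < +oo)%E.
Proof.
move=> ch h0 dG hg GB.
apply: (@le_lt_trans _ _ ((2 * B)%:E)); last exact: ltry.
apply: integral_setT_le => // H dH r r0.
have rr : - r <= r by lra.
have := @deriv_le_le R H G h g (- r) r rr (fun x _ => dH x) (fun x _ => dG x) (fun x _ => hg x).
have := GB r; have := GB (- r); rewrite !ler_norml; lra.
Qed.

End Integrals.

Section Eigenfunction.
Context {R : realType}.
Local Notation mu := (@lebesgue_measure R).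
Implicit Types (k x t a b E : R) (psi V u : R -> R).

Lemma sincos_period a (j : nat) :
  sin (a + j%:R * pi) * cos (a + j%:R * pi) = sin a * cos a.
Proof.
elim: j => [|j IH]; first by rewrite mul0r addr0.
by rewrite -natr1 mulrDl mul1r addrA sinDpi cosDpi mulrNN.
Qed.

(** The amplitude solves r' / r = Q sin psi cos psi, hence is an exponential.
*)
Lemma pruefer_solution k V E psi : continuous V -> 0 < k ->
  pruefer k (pruefer_coef k V E) psi -> exists u u' r : R -> R,
  [/\ forall x : R, is_derive x 1 u (u' x),
      forall x : R, is_derive x 1 u' ((V x - E) * u x) &
      forall x, [/\ 0 < r x, u x = r x * sin (psi x) & u' x = k * (r x * cos (psi x))]].
Proof.
move=> cV k0 d; pose Q := pruefer_coef k V E.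
have cpsi : continuous psi.
  by move=> x; exact: (@deriv_continuous R psi (fun x => k - Q x * sin (psi x) ^+ 2)).
have cq : continuous (fun x => Q x * (sin (psi x) * cos (psi x))).
  move=> x; apply: cvgM; first exact: continuous_pruefer_coef.
  have cs : {for x, continuous (fun x => sin (psi x))}.
    by apply: continuous_comp; [exact: cpsi | exact: continuous_sin].
  have cc : {for x, continuous (fun x => cos (psi x))}.
    by apply: continuous_comp; [exact: cpsi | exact: continuous_cos].
  exact: (cvgM cs cc).
have [F _ dF] := antiderivative 0 cq.
exists (fun x => expR (F x) * sin (psi x)), (fun x => k * (expR (F x) * cos (psi x))),
  (fun x => expR (F x)); split.
- move=> x; have ? := dF x; have ? := d x.
  apply: is_derive_eq; rewrite /GRing.scale /=.
  have -> : cos (psi x) * (k - Q x * sin (psi x) ^+ 2) =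
    k * cos (psi x) - cos (psi x) * Q x * sin (psi x) ^+ 2 by ring.
  ring.
- move=> x; have ? := dF x; have ? := d x.
  apply: is_derive_eq; rewrite /GRing.scale /=.
  have -> : V x - E = k * (Q x - k).
    by rewrite /Q /pruefer_coef; field; rewrite gt_eqF.
  have e := cos2Dsin2 (psi x).
  have -> : k * (Q x - k) * (expR (F x) * sin (psi x)) =
    k * Q x * expR (F x) * sin (psi x) * (cos (psi x) ^+ 2 + sin (psi x) ^+ 2)
     - k * k * (expR (F x) * sin (psi x)) by rewrite e; ring.
  rewrite -/Q; ring.
- by move=> x; split=> //; exact: expR_gt0.
Qed.

(** With p = u u', p' = u'^2 + (V - E) u^2 dominates u^2 + u'^2 for |x| >= X0,
and p is bounded: it is nondecreasing and of constant sign beyond X0 on each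
side. Adding a multiple of atan to p absorbs the bounded region, so that u^2 +
u'^2 is below the derivative of a bounded function on the whole line. *)
Lemma bound_state_integrable V E (X0 : R) (j : nat) k psi (u u' r : R -> R) :
  continuous V -> 0 < k -> 0 <= X0 -> (forall x, X0 <= `|x| -> E + 1 <= V x) ->
  decaying_angle X0 j psi ->
  (forall x : R, is_derive x 1 u (u' x)) ->
  (forall x : R, is_derive x 1 u' ((V x - E) * u x)) ->
  (forall x, [/\ 0 < r x, u x = r x * sin (psi x) & u' x = k * (r x * cos (psi x))]) ->
  (\int[mu]_x (u x ^+ 2 + u' x ^+ 2)%:E < +oo)%E.
Proof.
move=> cV k0 X00 VE [left right] du du' ur; have pi0 := pi_gt0 R.
have cu : continuous u by move=> x; exact: (@deriv_continuous R u u').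
have cu' : continuous u'.
  by move=> x; exact: (@deriv_continuous R u' (fun x => (V x - E) * u x)).
pose p x := u x * u' x; pose h x := u x ^+ 2 + u' x ^+ 2.
pose p' x := u' x ^+ 2 + (V x - E) * u x ^+ 2.
have dp (x : R) : is_derive x 1 p (p' x).
  have ? := du x; have ? := du' x.
  by rewrite /p; apply: is_derive_eq; rewrite /GRing.scale /= /p'; ring.
have ch : continuous h by move=> x; apply: cvgD; exact: continuous_sqr.
have cp : continuous p by move=> x; apply: cvgM; [exact: cu | exact: cu'].
have cp' : continuous p'.
  move=> x; apply: cvgD; first exact: continuous_sqr.
  apply: cvgM; last exact: continuous_sqr.
  by apply: cvgB; [exact: cV | exact: cvg_cst].
have h0 x : 0 <= h x by rewrite addr_ge0 ?sqr_ge0.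
have out x : X0 <= `|x| -> h x <= p' x.
  by move=> /VE VEx; rewrite /h /p'; have := sqr_ge0 (u x); nra.
have pE x : p x = k * r x ^+ 2 * (sin (psi x) * cos (psi x)).
  by rewrite /p; have [_ -> ->] := ur x; ring.
have kr x : 0 <= k * r x ^+ 2 by rewrite mulr_ge0 ?sqr_ge0 ?(ltW k0).
have sc0 a : 0 <= a <= pi / 2 -> 0 <= sin a * cos a.
  move=> /andP[a0 a1]; apply: mulr_ge0.
    by apply: sin_ge0_pi; apply/andP; split; lra.
  by apply: cos_ge0_pihalf; apply/andP; split; lra.
have pl x : x <= - X0 -> 0 <= p x.
  by move=> xX; rewrite pE mulr_ge0 // sc0 // left.
have pr x : X0 <= x -> p x <= 0.
  move=> xX; rewrite pE mulr_ge0_le0 //.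
  have := right x xX; set phi := j%:R * pi - psi x => /andP[h1 h2].
  have -> : psi x = - phi + j%:R * pi by rewrite /phi; ring.
  rewrite sincos_period sinN cosN mulNr oppr_le0 sc0 // /phi.
  by apply/andP; split; lra.
have [M1 M10 M1P] := bounded_itv (- X0) X0 cp.
have [M2 M20 M2P] := bounded_itv (- X0) X0 cp'.
have [M3 M30 M3P] := bounded_itv (- X0) X0 ch.
(* the factor 1 + X0^2 compensates the derivative of atan on [- X0, X0] *)
pose C := (M2 + M3) * (1 + X0 ^+ 2).
have C0 : 0 <= C by rewrite mulr_ge0 // ?addr_ge0 ?sqr_ge0.
have pM x : `|p x| <= M1.
  case: (leP X0 x) => xX.
    have h1 := pr x xX.
    have : p X0 <= p x.
      apply: (@deriv_ge0_le R p p' X0 x xX (fun x _ => dp x)) => t /andP[Xt _].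
      by apply: le_trans (out t _); rewrite ?h0 // ger0_norm //; lra.
    have := M1P X0; rewrite lexx andbT => /(_ _) m1.
    have : `|p X0| <= M1 by apply: m1; lra.
    rewrite !ler_norml; lra.
  case: (leP x (- X0)) => xX'.
    have h1 := pl x xX'.
    have : p x <= p (- X0).
      apply: (@deriv_ge0_le R p p' x (- X0) xX' (fun x _ => dp x)) => t /andP[_ Xt].
      by apply: le_trans (out t _); rewrite ?h0 // ler0_norm //; lra.
    have := M1P (- X0); rewrite lexx /= => /(_ _) m1.
    have : `|p (- X0)| <= M1 by apply: m1; lra.
    rewrite !ler_norml; lra.
  by apply: M1P; rewrite !ltW.
pose G x := p x + C * atan x; pose g x := p' x + C * (1 + x ^+ 2)^-1.
have dG (x : R) : is_derive x 1 G (g x).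
  have ? := dp x; have ? := is_derive1_atan x.
  by rewrite /G; apply: is_derive_eq; rewrite /GRing.scale /= /g; ring.
apply: (@integral_setT_lty R h g G (M1 + C * (pi / 2))) => //.
- move=> x; rewrite /g.
  have x1 : 0 < 1 + x ^+ 2 by rewrite ltr_pwDl ?sqr_ge0.
  have Cx : 0 <= C * (1 + x ^+ 2)^-1 by rewrite mulr_ge0 ?invr_ge0 ?(ltW x1).
  case: (leP X0 `|x|) => xX; first by have := out x xX; lra.
  have xb : - X0 <= x <= X0 by rewrite -ler_norml ltW.
  have := M2P x xb; have := M3P x xb; rewrite !ler_norml => h3 h2.
  suff : M2 + M3 <= C * (1 + x ^+ 2)^-1 by lra.
  rewrite /C ler_pdivlMr // ler_wpM2l ?addr_ge0 // lerD2l.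
  by rewrite -(real_normK (num_real x)) ler_pXn2r ?nnegrE // ltW.
- move=> x; rewrite /G; apply: (le_trans (ler_normD _ _)).
  apply: lerD; first exact: pM.
  rewrite normrM (ger0_norm C0) ler_wpM2l // ler_norml.
  by have := atan_gtNpi2 x; have := atan_ltpi2 x; rewrite /=; lra.
Qed.

Lemma bound_state_nonzero k psi (u u' r : R -> R) : 0 < k ->
  (forall x : R, is_derive x 1 u (u' x)) ->
  (forall x, [/\ 0 < r x, u x = r x * sin (psi x) & u' x = k * (r x * cos (psi x))]) ->
  exists x, u x != 0.
Proof.
move=> k0 du ur; apply/not_existsP => H.
have u0 x : u x = 0 by apply/eqP/negPn/negP; exact: H.
have u'0 : u' 0 = 0.
  have <- := is_derive_derive1 du; rewrite (_ : u = cst 0) ?derive1_cst //.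
  exact/funext.
have [r0 e1 e2] := ur 0; have e := cos2Dsin2 (psi 0).
move: e1 e2; rewrite u0 u'0 => /esym/eqP; rewrite mulf_eq0 (gt_eqF r0) /= => /eqP s0.
move=> /esym/eqP; rewrite !mulf_eq0 (gt_eqF r0) (gt_eqF k0) /= => /eqP c0.
by move: e; rewrite s0 c0 expr0n addr0 => /esym/eqP; rewrite oner_eq0.
Qed.

End Eigenfunction.

(** * Eigenfunctions on the cylinder *)

Section Cylinder.
Context {R : realType}.
Local Notation mu := (@lebesgue_measure R).
Local Notation dxdtheta := (@lebesgue_measure R \x @lebesgue_measure R)%E.

Lemma measurable_cylinder : measurable (@cylinder R).
Proof. by apply: measurableX => //; exact: measurable_itv. Qed.

Lemma measurable_fst_comp (h : R -> R) : continuous h ->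
  measurable_fun setT (fun p : R * R => h p.1).
Proof.
move=> ch; apply: (@measurableT_comp _ _ _ _ _ _ h); last exact: measurable_fst.
exact: continuous_measurable.
Qed.

Lemma lebesgue_period : mu `[0, 2 * pi[%classic = (2 * pi)%:E.
Proof.
have pi0 := pi_gt0 R.
by rewrite lebesgue_measure_itv /= lte_fin mulr_gt0 //= -EFinD subr0.
Qed.

(** Tonelli: the fibres of the cylinder have length 2 pi. *)
Lemma integral_cylinder (h : R -> R) : continuous h -> (forall x, 0 <= h x) ->
  (\int[dxdtheta]_(p in @cylinder R) (h p.1)%:E = (2 * pi)%:E * \int[mu]_x (h x)%:E)%E.
Proof.
move=> ch h0; have pi0 := pi_gt0 R.
have mh : measurable_fun setT (fun p : R * R => (h p.1)%:E).
  by apply/measurable_EFinP; exact: measurable_fst_comp.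
rewrite integral_mkcond fubini_tonelli1; last 2 first.
- apply/(measurable_restrictT _ measurable_cylinder).
  exact: measurable_funS mh.
- by move=> p; rewrite patchE; case: ifP => // _; rewrite lee_fin.
rewrite -ge0_integralZl; first last.
- by rewrite lee_fin mulr_ge0 // ltW.
- by move=> x _; rewrite lee_fin.
- by apply/measurable_EFinP; exact: continuous_measurable.
- exact: measurableT.
apply: eq_integral => x _; rewrite /fubini_F /=.
transitivity (\int[mu]_(y in `[0%R, (2 * pi)%R[%classic) (h x)%:E)%E.
  rewrite [RHS]integral_mkcond; apply: eq_integral => y _.
  rewrite !patchE; congr (if _ then _ else _).
  apply/idP/idP => [|yI].
    by rewrite inE /cylinder /= => -[_ yI]; rewrite inE.
  by rewrite inE /cylinder /=; split=> //; move: yI; rewrite inE.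
rewrite integral_cst; last exact: measurable_itv.
by rewrite muleC; congr (_ * _)%E; exact: lebesgue_period.
Qed.

Lemma sqnorm_real (f : R * R -> R[i]) (g : R -> R) : continuous g ->
  (forall p, complex.Re (f p) = g p.1 /\ complex.Im (f p) = 0) ->
  (sqnorm f = (2 * pi)%:E * \int[mu]_x (g x ^+ 2)%:E)%E.
Proof.
move=> cg fg; rewrite -(integral_cylinder (h := fun x => g x ^+ 2)); first last.
- by move=> x; exact: sqr_ge0.
- exact: continuous_sqr.
rewrite /sqnorm; apply: eq_integral => p _.
by have [-> ->] := fg p; rewrite expr0n addr0.
Qed.

(** Dominated convergence on the line: at each x the integrand vanishes as
soon as n >= |x|. *)
Lemma cvg_sqnorm_cutoff (f : nat -> R * R -> R[i]) (g : nat -> R -> R) (h : R -> R) (C : R) :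
  (forall n, continuous (g n)) -> continuous h -> (forall x, 0 <= h x) -> 0 <= C ->
  (\int[mu]_x (h x)%:E < +oo)%E ->
  (forall n x, g n x ^+ 2 <= C * h x) ->
  (forall n x, `|x| <= n%:R -> g n x = 0) ->
  (forall n p, complex.Re (f n p) = g n p.1 /\ complex.Im (f n p) = 0) ->
  sqnorm (f n) @[n --> \oo] --> 0%E.
Proof.
move=> cg ch h0 C0 hfin gh g0 fg; have pi0 := pi_gt0 R.
have -> : (fun n => sqnorm (f n)) = fun n => ((2 * pi)%:E * \int[mu]_x (g n x ^+ 2)%:E)%E.
  by apply/funext => n; exact: sqnorm_real.
rewrite -(mule0 (2 * pi)%:E); apply: cvgeZl => //.
have mh : measurable_fun setT (fun x => (C * h x)%:E).
  apply/measurable_EFinP; apply: measurable_funM; first exact: measurable_cst.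
  exact: continuous_measurable.
have [] := @dominated_convergence _ _ R mu setT measurableT
  (fun n x => (g n x ^+ 2)%:E) (cst 0%E) (fun x => (C * h x)%:E).
- by move=> n; apply/measurable_EFinP; apply: continuous_measurable => //; exact: continuous_sqr.
- exact: measurable_cst.
- apply: aeW => x _; apply: cvg_near_cst.
  exists (Num.truncn `|x|).+1 => // n /= nx.
  rewrite g0 ?expr0n //; apply: ltW; apply: (lt_le_trans (truncnS_gt _)).
  by rewrite ler_nat.
- apply/integrableP; split=> //.
  rewrite (_ : (fun x => _) = fun x => (C%:E * (h x)%:E)%E); last first.
    by apply/funext => x; rewrite gee0_abs ?lee_fin ?mulr_ge0 // EFinM.
  rewrite ge0_integralZl //; last 2 first.
  + by apply/measurable_EFinP; exact: continuous_measurable.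
  + by move=> x _; rewrite lee_fin.
  rewrite lte_mul_pinfty // ?lee_fin //.
- by apply: aeW => x n _; rewrite gee0_abs ?lee_fin ?sqr_ge0.
by move=> _ _; rewrite integral0.
Qed.

Lemma not_ae_zero (u : R -> R) (x0 : R) : continuous u -> u x0 != 0 ->
  ~ eq_ae (fun p : R * R => Complex (u p.1) 0) (fun=> 0).
Proof.
move=> cu ux [N [mN N0 NP]]; have pi0 := pi_gt0 R.
have : \forall x \near x0, `|u x0 - u x| < `|u x0|.
  by apply: (@cvgr_dist_lt _ _ _ _ _ u _ (cu x0)); rewrite normr_gt0.
move=> /nbhs_ballP[e /= e0 eP].
pose B : set (R * R) := `]x0 - e, x0 + e[%classic `*` `[0, 2 * pi[%classic.
have mB : measurable B by apply: measurableX; exact: measurable_itv.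
have BN : B `<=` N.
  move=> [x t] [/=]; rewrite in_itv /= => /andP[x1 x2] tpi; apply: NP => /= H.
  have /(congr1 (@complex.Re R)) /= ux0 : Complex (u x) 0 = 0 by exact: H.
  have : `|u x0 - u x| < `|u x0|.
    by apply: eP; rewrite /ball /= ltr_norml; apply/andP; split; lra.
  by rewrite ux0 subr0 ltxx.
have : (dxdtheta B <= dxdtheta N)%E by apply: le_measure; rewrite ?inE.
have BE : dxdtheta B = (2 * e * (2 * pi))%:E.
  have interval : mu `]x0 - e, x0 + e[%classic = (2 * e)%:E.
    rewrite lebesgue_measure_itv /= lte_fin (_ : (x0 - e < x0 + e) = true); last by lra.
    by rewrite -EFinD; congr EFin; ring.
  rewrite EFinM -interval -lebesgue_period.
  by apply: product_measure1E; exact: measurable_itv.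
rewrite N0 BE lee_fin leNgt => /negP; apply.
by rewrite !mulr_gt0.
Qed.

(** Any iterated partial derivative is again a smooth function of the first
coordinate, and it is 0 as soon as one differentiation is in the angle. *)
Lemma smooth2_fst (v : R -> R) : smooth v -> smooth2 (fun p : R * R => v p.1).
Proof.
move=> sv s; have [w sw ->] : exists2 w : R -> R, smooth w &
    foldr pderive (fun p : R * R => v p.1) s = fun p => w p.1.
  elim: s => [|b s [w sw IH]] /=; first by exists v.
  rewrite IH; case: b.
    exists (fun=> 0); first exact: smooth_cst.
    apply/funext => p; rewrite /pderive /= derive1E.
    exact: derive_cst.
  by have [sw' _] := smooth_derive sw; exists (derive1 w).
split.
  move=> p; apply: (@continuous_comp _ _ _ fst w); first exact: cvg_fst.
  exact: smooth_continuous.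
move=> [] p /=; first exact: derivable_cst.
exact: (sw 0%N).
Qed.

Lemma HRS1_fst (V v v1 v2 : R -> R) (F : R * R -> R) :
  (forall x : R, is_derive x 1 v (v1 x)) -> (forall x : R, is_derive x 1 v1 (v2 x)) ->
  (forall p, F p = v p.1) -> forall p, HRS1 V F p = - v2 p.1 + V p.1 * v p.1.
Proof.
move=> dv dv1 Fv p; have -> : F = fun p => v p.1 by exact/funext.
rewrite /HRS1 /HR /LapS1.
have -> : slice false (fun q : R * R => v q.1) p = v by [].
have -> : slice true (fun q : R * R => v q.1) p = cst (v p.1) by [].
rewrite !derive1nS !derive1n0 (is_derive_derive1 dv) (is_derive_derive1 dv1).
have d0 (c : R) : derive1 (cst c : R -> R) = cst 0.
  by apply/funext => x; rewrite derive1_cst.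
by rewrite !d0 /= subr0.
Qed.

(** The approximating test functions are chi_n u. Both chi_n u - u and H
(chi_n u) - E chi_n u = - chi_n'' u - 2 chi_n' u' vanish on |x| <= n and are
bounded by a fixed multiple of |u| + |u'|, which is square integrable. *)
Lemma eigenfunction_Hgraph (V u u' : R -> R) (E : R) : smooth V ->
  (forall x : R, is_derive x 1 u (u' x)) ->
  (forall x : R, is_derive x 1 u' ((V x - E) * u x)) ->
  (\int[mu]_x (u x ^+ 2 + u' x ^+ 2)%:E < +oo)%E ->
  H_eigenspace V E (fun p : R * R => Complex (u p.1) 0).
Proof.
move=> sV du du' hfin; have pi0 := pi_gt0 R.
have su : smooth u.
  have sq : smooth (fun x => V x - E) := smoothD sV (@smooth_cst R (- E)).
  exact: (smooth_schroedinger sq du du').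
have cu : continuous u by exact: smooth_continuous.
have cu' : continuous u'.
  by move=> x; exact: (@deriv_continuous R u' (fun x => (V x - E) * u x)).
pose h x := u x ^+ 2 + u' x ^+ 2.
have ch : continuous h by move=> x; apply: cvgD; exact: continuous_sqr.
have h0 x : 0 <= h x by rewrite addr_ge0 ?sqr_ge0.
have inL2u (c : R) : inL2 (fun p : R * R => c%:C%C * Complex (u p.1) 0).
  have e (p : R * R) : complex.Re (c%:C%C * Complex (u p.1) 0) = c * u p.1 /\
     complex.Im (c%:C%C * Complex (u p.1) 0) = 0 by rewrite /= !mul0r mulr0 subr0 addr0.
  have ccu : continuous (fun x => c * u x) by move=> x; apply: cvgM; [exact: cvg_cst | exact: cu].
  split.
  - rewrite (_ : (fun p => _) = fun p => c * u p.1); last by apply/funext => p; have [] := e p.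
    by apply: (measurable_funS measurableT) => //; exact: (@measurable_fst_comp (fun x => c * u x)).
  - rewrite (_ : (fun p => _) = fun p => 0); last by apply/funext => p; have [] := e p.
    exact: measurable_cst.
  - rewrite (sqnorm_real ccu e) lte_mul_pinfty // ?lee_fin ?mulr_ge0 ?(ltW pi0) //.
    apply: (@le_lt_trans _ _ (\int[mu]_x ((c ^+ 2)%:E * (h x)%:E))%E).
      apply: ge0_le_integral => //.
      + by move=> x _; rewrite lee_fin sqr_ge0.
      + by apply/measurable_EFinP; apply: continuous_measurable => //; exact: continuous_sqr.
      + apply: measurable_funeM; apply/measurable_EFinP; exact: continuous_measurable.
      + move=> x _; rewrite -EFinM lee_fin exprMn ler_wpM2l ?sqr_ge0 //.
        by rewrite /h lerDl sqr_ge0.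
    rewrite ge0_integralZl //; last 3 first.
    + by apply/measurable_EFinP; exact: continuous_measurable.
    + by move=> x _; rewrite lee_fin.
    + by rewrite lee_fin sqr_ge0.
    by rewrite lte_mul_pinfty // lee_fin sqr_ge0.
have [M [chi [chi1 [chi2 chiP]]]] := @cutoffs R.
have M0 : 0 <= M.
  by have [_ _ _ /(_ 0)[[+ _ _] _]] := chiP 0%N; exact: le_trans.
pose phi n (p : R * R) : R[i] := Complex (chi n p.1 * u p.1) 0.
split.
- have := inL2u 1; rewrite (_ : (fun p => _) = fun p : R * R => Complex (u p.1) 0) //.
  by apply/funext => p; rewrite mul1r.
- exact: inL2u.
exists phi; split.
- move=> n; have [sn _ _ nP] := chiP n; split.
  + exact: (smooth2_fst (smoothM sn su)).
  + exact: (smooth2_fst (@smooth_cst R 0)).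
  + by [].
  + exists n.+1%:R => x t nx; rewrite /phi /=.
    by have [_ [_ ->]] := nP x; [rewrite mul0r | exact: ltW].
- apply: (@cvg_sqnorm_cutoff _ (fun n x => chi n x * u x - u x) h ((M + 1) ^+ 2)) => //.
  + move=> n x; have [sn _ _ _] := chiP n.
    by apply: cvgB; [apply: cvgM; [exact: smooth_continuous | exact: cu] | exact: cu].
  + exact: sqr_ge0.
  + move=> n x; have [_ _ _ /(_ x)[[b _ _] _]] := chiP n.
    rewrite (_ : _ - _ = (chi n x - 1) * u x); last by ring.
    rewrite exprMn ler_pM ?sqr_ge0 //; last by rewrite /h lerDl sqr_ge0.
    rewrite -(real_normK (num_real (chi n x - 1))) ler_pXn2r ?nnegrE ?addr_ge0 //.
    by apply: (le_trans (ler_normB _ _)); rewrite normr1 lerD2r.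
  + move=> n x xn; have [_ _ _ /(_ x)[_ [/(_ xn)[-> _ _] _]]] := chiP n.
    by rewrite mul1r subrr.
  + by move=> n p; rewrite /phi /= subrr.
(* H (chi_n u) - E u, rewritten with u'' = (V - E) u *)
pose g n x := E * (chi n x - 1) * u x - chi2 n x * u x - 2 * (chi1 n x * u' x).
pose K : R := `|E| * (M + 1) + M + 2 * M.
have K0 : 0 <= K by rewrite /K !addr_ge0 ?mulr_ge0 ?addr_ge0.
apply: (@cvg_sqnorm_cutoff _ g h (2 * K ^+ 2)) => //.
- move=> n; have [sn d1 d2 _] := chiP n.
  have [s1 _] := smooth_derive sn; rewrite (is_derive_derive1 d1) in s1.
  have [s2 _] := smooth_derive s1; rewrite (is_derive_derive1 d2) in s2.
  have c0 := smooth_continuous sn; have c1 := smooth_continuous s1.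
  have c2 := smooth_continuous s2.
  move=> x; apply: cvgB.
    apply: cvgB; last by apply: cvgM; [exact: c2 | exact: cu].
    apply: cvgM; last exact: cu.
    by apply: cvgM; [exact: cvg_cst | apply: cvgB; [exact: c0 | exact: cvg_cst]].
  by apply: cvgM; [exact: cvg_cst | apply: cvgM; [exact: c1 | exact: cu']].
- by rewrite mulr_ge0 ?sqr_ge0.
- move=> n x; have [_ _ _ /(_ x)[[b0 b1 b2] _]] := chiP n.
  have gK : `|g n x| <= K * (`|u x| + `|u' x|).
    rewrite /g; apply: (le_trans (ler_normB _ _)).
    apply: (le_trans (lerD (ler_normB _ _) (lexx _))).
    rewrite !normrM (ger0_norm (ler0n _ 2)).
    have h1 : `|E| * `|chi n x - 1| * `|u x| <= `|E| * (M + 1) * `|u x|.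
      rewrite ler_wpM2r // ler_wpM2l //.
      by apply: (le_trans (ler_normB _ _)); rewrite normr1 lerD2r.
    have h2 : `|chi2 n x| * `|u x| <= M * `|u x| by rewrite ler_wpM2r.
    have h3 : `|chi1 n x| * `|u' x| <= M * `|u' x| by rewrite ler_wpM2r.
    have h4 : 0 <= `|E| * (M + 1) * `|u' x| by rewrite !mulr_ge0 ?addr_ge0.
    have h5 : 0 <= M * `|u x| by rewrite mulr_ge0.
    have h6 : 0 <= M * `|u' x| by rewrite mulr_ge0.
    rewrite /K; move: h1 h2 h3 h4 h5 h6; lra.
  rewrite -(real_normK (num_real (g n x))).
  apply: (@le_trans _ _ ((K * (`|u x| + `|u' x|)) ^+ 2)).
    have KS : 0 <= K * (`|u x| + `|u' x|) by apply: mulr_ge0 => //; exact: addr_ge0.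
    by rewrite ler_pXn2r ?nnegrE.
  have -> : 2 * K ^+ 2 * h x = K ^+ 2 * (2 * h x) by ring.
  rewrite exprMn; apply: ler_wpM2l; first exact: sqr_ge0.
  rewrite /h -(real_normK (num_real (u x))) -(real_normK (num_real (u' x))).
  by have := sqr_ge0 (`|u x| - `|u' x|); lra.
- move=> n x xn; have [_ _ _ /(_ x)[_ [/(_ xn)[e0 e1 e2] _]]] := chiP n.
  by rewrite /g e0 e1 e2; ring.
- move=> n p; have [_ d1 d2 _] := chiP n.
  have dchi (x : R) : is_derive x 1 (fun x => chi n x * u x) (chi1 n x * u x + chi n x * u' x).
    have ? := d1 x; have ? := du x.
    by apply: is_derive_eq; rewrite /GRing.scale /=; ring.
  have dchi1 (x : R) : is_derive x 1 (fun x => chi1 n x * u x + chi n x * u' x)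
      (chi2 n x * u x + 2 * (chi1 n x * u' x) + chi n x * ((V x - E) * u x)).
    have ? := d1 x; have ? := d2 x; have ? := du x; have ? := du' x.
    by apply: is_derive_eq; rewrite /GRing.scale /=; ring.
  have c0 (x : R) : is_derive x 1 (cst 0 : R -> R) 0 by exact: is_derive_cst.
  have := @HRS1_fst V (fun=> 0) (fun=> 0) (fun=> 0) (fun q => complex.Im (phi n q)) c0 c0 (fun q => erefl) p.
  have := @HRS1_fst V _ _ _ (fun q => complex.Re (phi n q)) dchi dchi1 (fun q => erefl) p.
  rewrite /HRS1C /= => -> ->.
  by rewrite /g; split; ring.
Qed.

End Cylinder.

(** * Counting eigenvalues and bounding the phase integral *)

Section Counting.
Context {R : realType}.
Local Notation mu := (@lebesgue_measure R).

(** A single nonzero eigenfunction is a linearly independent family. *)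
Lemma H_multiplicity_ge1 (V : R -> R) (E : R) : H_eigenvalue V E ->
  (1%:E <= H_multiplicity V E)%E.
Proof.
move=> [f fE f0]; apply: ereal_sup_ubound; exists 1%N => //.
exists (fun=> f); split=> // c H i.
apply/eqP/negPn/negP ; rewrite (ord1 i) => ci; apply: f0.
move: H => [N [mN N0 NP]]; exists N; split=> // p np; apply: NP => H; apply: np => Dp.
have := H Dp; rewrite big_ord_recl big_ord0 addr0 => /eqP.
by rewrite mulf_eq0 (negPf ci) /= => /eqP.
Qed.

Lemma H_multiplicity_ge0 (V : R -> R) (E : R) : (0%:E <= H_multiplicity V E)%E.
Proof.
apply: ereal_sup_ubound; exists 0%N => //.
by exists (fun=> fun=> 0); split=> [[]//|c _ []].
Qed.

Lemma H_counting_ge0 (V : R -> R) (lam : R) : (0 <= H_counting V lam)%E.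
Proof. by apply: esum_ge0 => E _; exact: H_multiplicity_ge0. Qed.

Lemma H_counting_ge (V : R -> R) (lam : R) (n : nat) (E : nat -> R) :
  (forall j, (0 < j <= n)%N -> H_eigenvalue V (E j) /\ E j < lam) ->
  (forall i j, (0 < i <= n)%N -> (0 < j <= n)%N -> E i = E j -> i = j) ->
  (n%:R%:E <= H_counting V lam)%E.
Proof.
move=> HE Einj; pose s := [seq E j | j <- iota 1 n].
have mem_s j : j \in iota 1 n -> (0 < j <= n)%N by rewrite mem_iota add1n ltnS.
have us : uniq s.
  by rewrite map_inj_in_uniq ?iota_uniq // => i j /mem_s ? /mem_s ?; exact: Einj.
apply: esum_ge; exists [set` s].
  split; first exact: finite_seq.
  by move=> _ /= /mapP[j /mem_s jn ->]; exact: HE.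
rewrite -fsbig_seq // big_map.
rewrite -[in X in (X%:R)](size_iota 1 n) -sum1_size natr_sum -sumEFin.
rewrite big_seq [leRHS]big_seq; apply: lee_sum => j /mem_s /HE[Ej _].
exact: H_multiplicity_ge1.
Qed.

End Counting.

Section LogPotential.
Context {R : realType}.
Implicit Types (V : R -> R) (A M x : R).
Local Notation mu := (@lebesgue_measure R).

(** The data of the theorem with the constants that the estimates use: the
threshold A is at least 1, so that the logarithm is nonnegative beyond it, and
M bounds V on [- A, A]. *)
Definition log_potential V A M : Prop :=
  [/\ smooth V, 1 <= A, forall x, A <= `|x| -> V x = Num.sqrt (ln `|x|),
      0 <= M & forall x, - A <= x <= A -> `|V x| <= M].

Lemma log_potential_near_le V A M x : log_potential V A M -> `|x| < A -> `|V x| <= M.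
Proof. by move=> [_ _ _ _ V_bounded] xA; apply: V_bounded; rewrite -ler_norml ltW. Qed.

Lemma log_potential_gt V A M x : log_potential V A M -> - M - 1 < V x.
Proof.
move=> HV; have [V_smooth A1 V_log M0 V_bounded] := HV.
case: (leP A `|x|) => [/V_log ->|/(log_potential_near_le HV)]; last by rewrite ler_norml; lra.
have h : - M - 1 < 0 by lra.
exact: (lt_le_trans h (sqrtr_ge0 _)).
Qed.

Lemma log_potential_ge V A M (s x : R) : log_potential V A M -> 0 <= s -> A <= `|x| -> expR (s ^+ 2) <= `|x| -> s <= V x.
Proof.
move=> [V_smooth A1 V_log M0 V_bounded] s0 Ax sx; rewrite V_log //.
have x0 : 0 < `|x| by lra.
rewrite -{1}(ger0_norm s0) -(sqrtr_sqr s) ler_wsqrtr //.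
by rewrite -ler_expR lnK.
Qed.

Lemma log_potential_le V A M (s x : R) : log_potential V A M -> 0 <= s -> M <= s -> `|x| <= expR (s ^+ 2) -> V x <= s.
Proof.
move=> HV s0 Ms xs; have [V_smooth A1 V_log M0 V_bounded] := HV.
case: (leP A `|x|) => [Ax|/(log_potential_near_le HV)]; last first.
  by rewrite ler_norml; lra.
have x0 : 0 < `|x| by lra.
rewrite V_log // -[leRHS](ger0_norm s0) -(sqrtr_sqr s) ler_wsqrtr //.
by rewrite -ler_expR lnK.
Qed.

(** Choose k^2 = 1 / (2 lam), L = e^(lam^2 - 2) and E1 = lam - 1 / (2 lam).
Since (lam - 1 / lam)^2 >= lam^2 - 2, on [- L, L] the potential is at most lam
- 1 / lam = E1 - k^2, as shooting requires, and all energies obtained are at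
most E1 < lam. *)
Lemma H_counting_lower V A M (lam : R) (n : nat) : log_potential V A M -> M + 1 <= lam ->
  n%:R * pi <= 2 * (Num.sqrt (2 * lam))^-1 * expR (lam ^+ 2 - 2) ->
  (n%:R%:E <= H_counting V lam)%E.
Proof.
move=> HV lamM nL; have [V_smooth A1 V_log M0 V_bounded] := HV.
have lam1 : 1 <= lam by lra.
have lam0 : 0 < lam by lra.
pose k : R := (Num.sqrt (2 * lam))^-1.
have s0 : 0 < Num.sqrt (2 * lam) by rewrite sqrtr_gt0; lra.
have k0 : 0 < k by rewrite invr_gt0.
have k2 : k ^+ 2 = (2 * lam)^-1 by rewrite /k exprVn sqr_sqrtr //; lra.
have il : 0 < lam^-1 <= 1 by rewrite invr_gt0 lam0 /= invf_le1.
have ill : lam * lam^-1 = 1 by rewrite mulfV // gt_eqF.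
pose E1 := lam - (2 * lam)^-1; pose L := expR (lam ^+ 2 - 2).
have i2 : (2 * lam)^-1 = lam^-1 / 2 by rewrite invfM mulrC.
have cV : continuous V by exact: smooth_continuous.
pose X0 := A + expR ((lam + 1) ^+ 2).
have X00 : 0 <= X0 by rewrite addr_ge0 ?expR_ge0 //; lra.
have farV x : X0 <= `|x| -> lam + 1 <= V x.
  move=> xX; apply: (log_potential_ge HV); first by lra.
    by apply: le_trans xX; rewrite lerDl expR_ge0.
  by apply: le_trans xX; rewrite lerDr; lra.
have nearV x : - L <= x <= L -> V x <= E1 - k ^+ 2.
  rewrite -ler_norml => xL; rewrite k2 /E1 i2.
  have -> : lam - lam^-1 / 2 - lam^-1 / 2 = lam - lam^-1 by field; rewrite gt_eqF.
  apply: (log_potential_le HV); [by lra | by lra | apply: (le_trans xL)].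
  rewrite /L ler_expR.
  have -> : (lam - lam^-1) ^+ 2 = lam ^+ 2 - 2 * (lam * lam^-1) + lam^-1 ^+ 2 by ring.
  by rewrite ill mulr1 lerDl sqr_ge0.
have bs j : (0 < j <= n)%N -> exists Epsi : R * (R -> R),
    [/\ Epsi.1 <= E1, pruefer k (pruefer_coef k V Epsi.1) Epsi.2 & decaying_angle X0 j Epsi.2].
  move=> /andP[j0 jn].
  have [|||E [psi [/andP[_ EE1] d dec]]] :=
    @bound_state_angle R k V (- M - 1) E1 L X0 j cV k0 (fun x => log_potential_gt x HV) _ X00 nearV _ j0 _.
  - exact: expR_ge0.
  - by move=> x /farV; rewrite /E1 i2; lra.
  - apply: le_trans nL; rewrite ler_wpM2r ?pi_ge0 ?ler_nat //.
  by exists (E, psi).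
have /choice[Ep EpP] : forall j, exists Epsi : R * (R -> R), (0 < j <= n)%N ->
    [/\ Epsi.1 <= E1, pruefer k (pruefer_coef k V Epsi.1) Epsi.2 & decaying_angle X0 j Epsi.2].
  move=> j; case: (boolP (0 < j <= n)%N) => [/bs[Epsi h]|_]; first by exists Epsi.
  by exists (0, cst 0).
apply: (@H_counting_ge R V lam n (fun j => (Ep j).1)) => [j /EpP[EE1 d dec]|i j].
  have Elam : (Ep j).1 < lam by rewrite (le_lt_trans EE1) // /E1 i2; lra.
  split=> //.
  have [u [u' [r [du du' ur]]]] := pruefer_solution cV k0 d.
  have fin := @bound_state_integrable R V (Ep j).1 X0 j k _ u u' r cV k0 X00 _ dec du du' ur.
  have [x0 ux0] := bound_state_nonzero k0 du ur.
  exists (fun p => Complex (u p.1) 0).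
    apply: (@eigenfunction_Hgraph R V u u' (Ep j).1 V_smooth du du'); apply: fin.
    by move=> x /farV; lra.
  apply: (not_ae_zero (x0 := x0)) => //.
  by move=> x; exact: (@deriv_continuous R u u').
move=> /EpP[Ei di deci] /EpP[Ej dj decj] eij.
rewrite -eij in dj.
apply: (@bound_state_unique R k V (Ep i).1 X0 _ _ i j k0 cV _ X00 di dj deci decj).
by move=> x /farV; rewrite /E1 i2 in Ei *; lra.
Qed.

(** Write T = e^(lam^2). The integrand (lam - V)_+ vanishes for |x| >= T, and
for |x| <= T it is at most g / lam, where g is the derivative of G x = x ln (2
T^2 / (1 + x^2)) + 2 x: away from 0 because lam - sqrt y <= (lam^2 - y) / lam
with y = ln |x|, near 0 because g is about 2 lam^2. Finally G T - G (- T) <= 6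
T. *)
Lemma phase_integral_upper V A M (lam : R) : log_potential V A M -> M + ln (1 + A ^+ 2) + 1 <= lam -> A <= lam ->
  (phase_integral V lam <= (2 * pi * (6 * expR (lam ^+ 2) / lam))%:E)%E.
Proof.
move=> HV lamM lamA; have [V_smooth A1 V_log M0 V_bounded] := HV.
pose T := expR (lam ^+ 2).
have lam1 : 1 <= lam by lra.
have lam0 : 0 < lam by lra.
have pi0 := pi_gt0 R.
have cV : continuous V by exact: smooth_continuous.
have TA : A <= T by rewrite /T; have := expR_ge1Dx (lam ^+ 2); nra.
pose h (x : R) : R := Num.max (lam - V x) 0.
have ch : continuous h.
  have cd : continuous (fun x => lam - V x).
    by move=> x; apply: cvgB; [exact: cvg_cst | exact: cV].
  have -> : h = fun x => (lam - V x + `|lam - V x|) / 2.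
    by apply/funext => x; rewrite /h maxr_absE addr0 subr0.
  move=> x; apply: cvgM; last exact: cvg_cst.
  by apply: cvgD; [exact: cd | apply: cvg_norm; exact: cd].
have h0 x : 0 <= h x by rewrite le_max lexx orbT.
have hout x : T <= `|x| -> h x = 0.
  move=> Tx; apply/max_idPr; rewrite subr_le0; apply: (log_potential_ge HV) => //; [lra | exact: le_trans TA Tx].
pose C := ln 2 + 2 * lam ^+ 2.
pose G x := x * (C - ln (1 + x ^+ 2)) + 2 * x.
pose g x := C - ln (1 + x ^+ 2) + 2 / (1 + x ^+ 2).
have pos x : 0 < 1 + x ^+ 2 by rewrite ltr_pwDl ?sqr_ge0.
have dG (x : R) : is_derive x 1 G (g x).
  have dl := is_derive1_ln (pos x).
  have dln : is_derive x 1 (fun x : R => ln (1 + x ^+ 2)) ((1 + x ^+ 2)^-1 * (2 * x)).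
    have dq : is_derive x 1 (fun x : R => 1 + x ^+ 2) (2 * x).
      by apply: is_derive_eq; rewrite /GRing.scale /=; ring.
    exact: (@is_derive1_comp R (@ln R) (fun x => 1 + x ^+ 2) x _ _ dl dq).
  rewrite /G; apply: is_derive_eq; rewrite /GRing.scale /= /g; field.
  by rewrite gt_eqF.
have ln2 : 0 <= ln (2 : R) <= 1.
  apply/andP; split; first by rewrite ln_ge0 // ler1n.
  by rewrite -ler_expR lnK ?posrE //; have := expR_ge1Dx (1 : R); lra.
have hg x : `|x| <= T -> lam * h x <= g x.
  move=> xT.
  have g1 : C - ln (1 + x ^+ 2) <= g x by rewrite lerDl divr_ge0 ?(ltW (pos x)).
  apply: le_trans g1.
  have x2 : x ^+ 2 = `|x| ^+ 2 by rewrite real_normK // num_real.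
  case: (leP A `|x|) => xA.
    have x0 : 0 < `|x| by lra.
    have lnx : 0 <= ln `|x| by rewrite ln_ge0; lra.
    have lnxT : ln `|x| <= lam ^+ 2 by rewrite -ler_expR lnK.
    have l1 : ln (1 + x ^+ 2) <= ln 2 + 2 * ln `|x|.
      have -> : ln 2 + 2 * ln `|x| = ln (2 * `|x| ^+ 2).
        by rewrite lnM ?posrE ?exprn_gt0 // lnXn // mulr_natl.
      rewrite ler_ln ?posrE ?pos ?mulr_gt0 ?exprn_gt0 // x2.
      have : 1 <= `|x| ^+ 2 by rewrite exprn_ege1 //; lra.
      lra.
    apply: (@le_trans _ _ (lam ^+ 2 - ln `|x|)); last by rewrite /C; lra.
    rewrite /h V_log //; set y := Num.sqrt _.
    have y0 : 0 <= y by exact: sqrtr_ge0.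
    have y2 : y ^+ 2 = ln `|x| by rewrite sqr_sqrtr.
    have yl : y <= lam by rewrite -(@ler_pXn2r _ 2) ?nnegrE ?(ltW lam0) // y2.
    rewrite (max_idPl _) ?subr_ge0 // -y2.
    have -> : lam ^+ 2 - y ^+ 2 = lam * (lam - y) + y * (lam - y) by ring.
    by rewrite lerDl mulr_ge0 // subr_ge0.
  have hM : h x <= lam + M.
    rewrite /h ge_max; apply/andP; split; last by lra.
    by have := log_potential_near_le HV xA; rewrite ler_norml; lra.
  have l1 : ln (1 + x ^+ 2) <= ln (1 + A ^+ 2).
    rewrite ler_ln ?posrE ?pos // lerD2l x2 ler_pXn2r ?nnegrE //; lra.
  have l2 : 0 <= ln (1 + A ^+ 2) by rewrite ln_ge0 // lerDl sqr_ge0.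
  have : lam * h x <= lam * (lam + M) by rewrite ler_wpM2l // ltW.
  rewrite /C; nra.
have int_h : (\int[mu]_x (h x)%:E <= (6 * T / lam)%:E)%E.
  apply: integral_setT_le => // H dH r r0.
  have T0 : 0 < T by exact: expR_gt0.
  have mono a b : a <= b -> H a <= H b.
    by move=> ab; exact: (@deriv_ge0_le R H h a b ab (fun x _ => dH x)).
  have up : H r <= H T.
    case: (leP r T) => [/mono //|/ltW rT].
    apply: (@deriv_le0_ge R H h T r rT (fun x _ => dH x)) => t /andP[Tt _].
    by rewrite hout // ger0_norm //; lra.
  have dn : H (- T) <= H (- r).
    case: (leP r T) => [rT|/ltW rT]; first by apply: mono; lra.
    have rT' : - r <= - T by lra.
    apply: (@deriv_le0_ge R H h _ _ rT' (fun x _ => dH x)) => t /andP[_ tT].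
    by rewrite hout // ler0_norm //; lra.
  have TT : - T <= T by lra.
  have dlH (x : R) : is_derive x 1 (fun x => lam * H x) (lam * h x).
    by have ? := dH x; apply: is_derive_eq; rewrite /GRing.scale /=; ring.
  have := @deriv_le_le R (fun x => lam * H x) G _ g (- T) T TT (fun x _ => dlH x) (fun x _ => dG x).
  move=> /(_ _) HG.
  have {HG} HG : lam * H T - lam * H (- T) <= G T - G (- T).
    by apply: HG => x xT; apply: hg; rewrite ler_norml.
  have lnT : 2 * lam ^+ 2 <= ln (1 + T ^+ 2).
    have -> : 2 * lam ^+ 2 = ln (T ^+ 2) by rewrite lnXn // /T expRK mulr_natl.
    by rewrite ler_ln ?posrE ?pos ?exprn_gt0 // lerDr.
  have GT : G T - G (- T) <= 6 * T.
    rewrite /G sqrrN /C.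
    have -> : T * (ln 2 + 2 * lam ^+ 2 - ln (1 + T ^+ 2)) + 2 * T -
      (- T * (ln 2 + 2 * lam ^+ 2 - ln (1 + T ^+ 2)) + 2 * - T) =
      2 * (T * (ln 2 + 2 * lam ^+ 2 - ln (1 + T ^+ 2))) + 4 * T by ring.
    have : T * (ln 2 + 2 * lam ^+ 2 - ln (1 + T ^+ 2)) <= T * 1.
      by rewrite ler_wpM2l ?(ltW T0) //; lra.
    lra.
  by rewrite ler_pdivlMr //; nra.
have -> : phase_integral V lam = ((2 * pi)%:E * \int[mu]_x (h x)%:E)%E.
  rewrite /phase_integral integral_cst; last exact: measurable_itv.
  by rewrite [LHS]muleC; congr (_ * _)%E; exact: lebesgue_period.
rewrite [X in (_ <= X)%E]EFinM; apply: lee_wpmul2l => //.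
by rewrite lee_fin mulr_ge0 // ltW.
Qed.

Lemma phase_integral_ge0 V (lam : R) : (0 <= phase_integral V lam)%E.
Proof.
apply: integral_ge0 => t _; apply: integral_ge0 => x _.
by rewrite lee_fin le_max lexx orbT.
Qed.

(** With Y = e^(lam^2) / lam the phase integral is at most 12 pi Y, and the
number of eigenvalues is at least c sqrt (2 lam) Y - 1 with c = e^(- 2) / pi;
the factor sqrt lam wins. *)
Lemma phase_integral_little_o V A M : log_potential V A M ->
  little_o (phase_integral V) (H_counting V).
Proof.
move=> HV eps eps0; have [V_smooth A1 V_log M0 V_bounded] := HV.
have pi0 := pi_gt0 R.
pose c : R := expR (- 2) / pi.
have c0 : 0 < c by rewrite divr_gt0 ?expR_gt0.
(* once sqrt (2 lam) >= B, c sqrt (2 lam) Y - 1 >= 12 pi Y / eps, since Y >= 1 *)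
pose B := (12 * pi / eps + 1) / c.
have B0 : 0 <= B by rewrite divr_ge0 ?(ltW c0) // addr_ge0 // divr_ge0 ?(ltW eps0) // mulr_ge0 // ltW.
exists (M + ln (1 + A ^+ 2) + 1 + A + B ^+ 2); split; first exact: num_real.
move=> lam lamB.
have l2 : 0 <= ln (1 + A ^+ 2) by rewrite ln_ge0 // lerDl sqr_ge0.
have BB := sqr_ge0 B.
have lam0 : 0 < lam by lra.
rewrite gee0_abs ?phase_integral_ge0 // gee0_abs ?H_counting_ge0 //.
pose s : R := Num.sqrt (2 * lam).
have s0 : 0 < s by rewrite sqrtr_gt0; lra.
have s2 : s ^+ 2 = 2 * lam by rewrite sqr_sqrtr //; lra.
have sB : B <= s.
  by rewrite -(@ler_pXn2r _ 2) ?nnegrE ?(ltW s0) // s2; lra.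
pose Y := expR (lam ^+ 2) / lam.
have Y1 : 1 <= Y.
  by rewrite ler_pdivlMr // mul1r; have := expR_ge1Dx (lam ^+ 2); nra.
pose z : R := 2 * s^-1 * expR (lam ^+ 2 - 2) / pi.
have zE : z = c * s * Y.
  have e : 2 / s = s / lam.
    have gen (a b : R) : 0 < a -> b = a ^+ 2 / 2 -> 2 / a = a / b.
      by move=> a0 ->; field; rewrite gt_eqF.
    by apply: gen => //; lra.
  by rewrite /z /c /Y expRD e; ring.
pose n := Num.truncn z.
have z0 : 0 <= z.
  by rewrite zE; apply: mulr_ge0; [apply: mulr_ge0; exact: ltW | lra].
have /andP[nz zn] := truncn_itv z0.
have nN : (n%:R%:E <= H_counting V lam)%E.
  apply: (H_counting_lower HV); first by lra.
  by rewrite -ler_pdivlMr.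
apply: (@le_trans _ _ (eps * n%:R)%:E); last first.
  by rewrite EFinM lee_pmul2l // lte_fin.
apply: (le_trans (phase_integral_upper HV _ _)); [lra | lra | ].
rewrite lee_fin.
have -> : 2 * pi * (6 * expR (lam ^+ 2) / lam) = 12 * pi * Y by rewrite /Y; field; rewrite gt_eqF.
have h1 : 12 * pi / eps + 1 <= c * s.
  have := ler_wpM2l (ltW c0) sB.
  by rewrite {1}/B mulrCA mulfV ?mulr1 // gt_eqF.
have h2 : 12 * pi / eps + 1 <= c * s -> (12 * pi / eps + 1) * Y <= z.
  by move=> h; rewrite zE ler_wpM2r //; lra.
have h3 : 12 * pi / eps * Y <= n%:R.
  move: (h2 h1) zn; rewrite -natr1 -/n mulrDl mul1r; lra.
have := ler_wpM2l (ltW eps0) h3.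
have -> : eps * (12 * pi / eps * Y) = 12 * pi * Y by field; rewrite gt_eqF.
by [].
Qed.

(** If the quotient tended to 1 it would eventually lie between 1/2 and 2; a
vanishing phase integral makes it 0 or +oo, and otherwise the little-o
estimate with constant 1 / (4 c) makes it at least 4. *)
Lemma Weyl_law_fails V A M (c : R) : log_potential V A M -> 0 < c ->
  ~ asymp_equiv (H_counting V) (fun lam => c%:E * phase_integral V lam)%E.
Proof.
move=> HV c0 H; have [V_smooth A1 V_log M0 V_bounded] := HV.
have e0 : 0 < (4 * c)^-1 by rewrite invr_gt0 mulr_gt0.
have lo := phase_integral_little_o HV e0.
have lt2 : \forall lam \near +oo%R, (H_counting V lam / (c%:E * phase_integral V lam) < 2%:E)%E.
  apply: (H [set y | (y < 2%:E)%E]); apply: open_nbhs_nbhs; split.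
    exact: open_ereal_lt_ereal.
  by rewrite /= lte_fin; lra.
have gt2 : \forall lam \near +oo%R, (2^-1%:E < H_counting V lam / (c%:E * phase_integral V lam))%E.
  apply: (H [set y | (2^-1%:E < y)%E]); apply: open_nbhs_nbhs; split.
    exact: open_ereal_gt_ereal.
  by rewrite /= lte_fin; lra.
have l2 : 0 <= ln (1 + A ^+ 2) by rewrite ln_ge0 // lerDl sqr_ge0.
have big : \forall lam \near +oo%R, M + ln (1 + A ^+ 2) + 1 + A <= lam.
  by apply: nbhs_pinfty_ge; exact: num_real.
have [lam [[[+ lt2N] gt2N] lamb]] := filter_ex (filterI (filterI (filterI lo lt2) gt2) big).
rewrite !gee0_abs ?phase_integral_ge0 ?H_counting_ge0 // => loN.
have pfin : phase_integral V lam \is a fin_num.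
  rewrite ge0_fin_numE ?phase_integral_ge0 //.
  by apply: (le_lt_trans (phase_integral_upper HV _ _)); [lra|lra|exact: ltry].
move: loN lt2N gt2N (phase_integral_ge0 V lam) (H_counting_ge0 V lam).
rewrite -(fineK pfin); move: (fine _) (H_counting V lam) => q N.
rewrite -EFinM inver lee_fin mulf_eq0 (gt_eqF c0) /=.
case: (eqVneq q 0) => [-> _ lt2N gt2N _ N0|qn0].
  move: lt2N gt2N; have [->|Nn0] := eqVneq N 0%E; first by rewrite mul0e => _; rewrite lte_fin ltNge invr_ge0 ler0n.
  by rewrite gt0_muley ?lt0e ?Nn0.
case: N => [v|_|//]; last first.
  by move=> lt2N _ q0; move: lt2N; rewrite gt0_mulye // lte_fin invr_gt0 mulr_gt0 // lt0r qn0.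
rewrite -!EFinM !lee_fin !lte_fin => lo' lt2N _ q0 v0.
have q0' : 0 < q by rewrite lt0r qn0.
have cq0 : 0 < c * q by rewrite mulr_gt0.
move: lt2N; rewrite ltr_pdivrMr // => lt2N.
have := ler_wpM2l (_ : 0 <= 4 * c) lo'; rewrite mulrA mulfV; last by rewrite gt_eqF // mulr_gt0.
by rewrite mul1r => /(_ _) h; have := h (ltW (mulr_gt0 _ c0)); lra.
Qed.

End LogPotential.

Theorem mainTheorem3 (R : realType) (V : R -> R)
    (V_smooth : smooth V)
    (V_log : exists A : R, forall x : R,
        A <= `|x| -> V x = Num.sqrt (ln `|x|)) :
  little_o (phase_integral V) (H_counting V) /\
  ~ asymp_equiv (H_counting V)
      (fun lam => ((2 * pi)^-2 * omega2)%:E * phase_integral V lam)%E.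
Proof.
have [A0 VA] := V_log; pose A := Num.max A0 1.
have [M M0 VM] := bounded_itv (- A) A (smooth_continuous V_smooth).
have HV : log_potential V A M.
  split=> // [|x Ax]; first by rewrite le_max lexx orbT.
  by apply: VA; apply: le_trans Ax; rewrite le_max lexx.
split; first exact: phase_integral_little_o HV.
apply: (Weyl_law_fails HV).
by rewrite mulr_gt0 ?pi_gt0 // invr_gt0 exprn_gt0 // mulr_gt0 ?pi_gt0.
Qed.
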